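(* Let $f$ be of the KPP type. Let $h\ge0$, $c>0$, $\nu\in\mathbb R^m$, $|\nu|=1$. Then the equation $$u_t(t,x)=\Delta u(t,x)+f(u(t,x),u(t-h,x)),\quad x\in\mathbb R^m,$$ has a monotone front $u=\phi(\nu\cdot x+ct)$ if and only if $(h,c)\in\mathcal D_{\mathfrak L}$.
   Context: $f:\mathbb R^2\to\mathbb R$, $f_j=\partial f/\partial x_j$, $\kappa>0$, $\alpha_0=f_1(0,0)$, $\beta_0=f_2(0,0)$, $\alpha_\kappa=f_1(\kappa,\kappa)$, $\beta_\kappa=f_2(\kappa,\kappa)$. $f$ is monostable: $g(x):=f(x,x)$ satisfies $g(0)=g(\kappa)=0$, $g'(0)>0$, $g'(\kappa)<0$, $g>0$ on $(0,\kappa)$. A monostable $f$ is of the KPP type if $f\in C^{1,\gamma}$ for some $\gamma\in(0,1]$, $\alpha_0>0$, $\beta_0=0$, $\alpha_\kappa=0$, $\beta_\kappa<0$, $f(0,y)\equiv0$, and for all $x,y\in(0,\kappa)$: $0<f_1(x,y)\le\alpha_0$, $f_2(x,y)\le0$, $0<f(x,y)\le\beta_\kappa(y-\kappa)$. A monotone front is a solution $u=\phi(\nu\cdot x+ct)$ with positive monotone $C^2$ profile $\phi:\mathbb R\to(0,\kappa)$, $\phi(-\infty)=0$, $\phi(+\infty)=\kappa$; i.e. $\phi''(t)-c\phi'(t)+f(\phi(t),\phi(t-ch))=0$ on $\mathbb R$. $\mathcal D_{\mathfrak L}=\{(h,c)\in\mathbb R^2:h\ge0,\ c_0^{\mathfrak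 L}(h)\le c\le c_\kappa^{\mathfrak L}(h)\}$, where $c_0^{\mathfrak L}(h)>0$ is the number such that $z^2-cz+\alpha_0+\beta_0e^{-chz}=0$ has a real root iff $c\ge c_0^{\mathfrak L}(h)$ (here $c_0^{\mathfrak L}(h)=2\sqrt{\alpha_0}$ since $\beta_0=0$), and, for $h>0$, $c_\kappa^{\mathfrak L}(h)\in(0,+\infty]$ is the number such that $z^2-cz+\alpha_\kappa+\beta_\kappa e^{-chz}=0$ (here $\alpha_\kappa=0$), $c>0$, has a negative real root iff $c\le c_\kappa^{\mathfrak L}(h)$; $c_\kappa^{\mathfrak L}(0)=+\infty$. *)

(* Defs.v *)
From HB Require Import structures.
From mathcomp Require Import all_boot all_order all_algebra.
From mathcomp Require Import all_classical all_reals all_analysis.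

Set Implicit Arguments.
Unset Strict Implicit.
Unset Printing Implicit Defensive.

Import Order.TTheory GRing.Theory Num.Theory.
Import numFieldNormedType.Exports.

Local Open Scope classical_set_scope.
Local Open Scope ring_scope.

Section Nonlinearity.
Variable R : realType.
Implicit Types (f g : R * R -> R) (kappa gamma : R).

Definition pd1 f (p : R * R) : R := 'D_((1, 0) : R * R) f p.
Definition pd2 f (p : R * R) : R := 'D_((0, 1) : R * R) f p.

(* Hoelder continuity on bounded sets; on [R * R], [`| _ |] is the max norm,
   which is equivalent to the Euclidean one *)
Definition locally_hoelder gamma g : Prop :=
  forall M : R, exists C : R, forall p q : R * R,
    `|p| <= M -> `|q| <= M -> `|g p - g q| <= C * `|p - q| `^ gamma.

Definition C1gamma gamma f : Prop :=
  [/\ forall p, derivable f p ((1, 0) : R * R),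
      forall p, derivable f p ((0, 1) : R * R),
      locally_hoelder gamma (pd1 f) &
      locally_hoelder gamma (pd2 f)].

Definition monostable f kappa : Prop :=
  let g : R -> R := fun x => f (x, x) in
  [/\ g 0 = 0, g kappa = 0,
      derivable g 0 1 /\ 0 < derive1 g 0,
      derivable g kappa 1 /\ derive1 g kappa < 0 &
      forall x, 0 < x < kappa -> 0 < g x].

Definition KPP_type f kappa : Prop :=
  let alpha0 := pd1 f (0, 0) in
  let beta0 := pd2 f (0, 0) in
  let alphak := pd1 f (kappa, kappa) in
  let betak := pd2 f (kappa, kappa) in
  [/\ monostable f kappa,
      exists gamma, 0 < gamma <= 1 /\ C1gamma gamma f,
      [/\ 0 < alpha0, beta0 = 0, alphak = 0 & betak < 0],
      forall y, f (0, y) = 0 &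
      forall x y, 0 < x < kappa -> 0 < y < kappa ->
        [/\ 0 < pd1 f (x, y) <= alpha0, pd2 f (x, y) <= 0 &
            0 < f (x, y) <= betak * (y - kappa)]].

End Nonlinearity.

Section CriticalSpeeds.
Variable R : realType.
Implicit Types (f : R * R -> R) (alpha beta h c z : R).

Definition char_fun alpha beta h c z : R :=
  z ^+ 2 - c * z + alpha + beta * expR (- (c * h * z)).

(* The speeds are definite descriptions: [xget] selects the (unique) element
   of the set; its first argument is only used if the set is empty. The
   characterizing equivalences range over positive speeds [c]. *)
Definition c0L alpha beta h : R :=
  xget 0 [set c0 : R | 0 < c0 /\ forall c, 0 < c ->
    ((exists z, char_fun alpha beta h c z = 0) <-> c0 <= c)].

Definition ckL alpha beta h : \bar R :=
  if h == 0 then +oo%E else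
  xget +oo%E [set ck : \bar R | (0 < ck)%E /\ forall c, 0 < c ->
    ((exists z, z < 0 /\ char_fun alpha beta h c z = 0) <->
     (c%:E <= ck)%E)].

Definition DL f (kappa : R) : set (R * R) :=
  [set hc | [/\ 0 <= hc.1,
     c0L (pd1 f (0, 0)) (pd2 f (0, 0)) hc.1 <= hc.2 &
     (hc.2%:E <=
        ckL (pd1 f (kappa, kappa)) (pd2 f (kappa, kappa)) hc.1)%E]].

End CriticalSpeeds.

Section Fronts.
Variables (R : realType) (m : nat).
Implicit Types (f : R * R -> R) (u : R -> 'rV[R]_m -> R) (nu x : 'rV[R]_m).

Definition dotv nu x : R := \sum_(i < m) nu 0 i * x 0 i.

(* [`| _ |] on ['rV[R]_m] is the max norm, hence this definition *)
Definition enorm x : R := Num.sqrt (dotv x x).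

Definition basis_vec (i : 'I_m) : 'rV[R]_m := delta_mx 0 i.

Definition laplacian (v : 'rV[R]_m -> R) x : R :=
  \sum_(i < m) 'D_(basis_vec i) (fun y => 'D_(basis_vec i) v y) x.

Definition is_solution f h u : Prop :=
  forall (t : R) x,
    [/\ derivable (fun s => u s x) t 1,
        forall i, derivable (u t) x (basis_vec i),
        forall i,
          derivable (fun y => 'D_(basis_vec i) (u t) y) x (basis_vec i) &
        derive1 (fun s => u s x) t = laplacian (u t) x + f (u t x, u (t - h) x)].

Definition front_profile (kappa : R) (phi : R -> R) : Prop :=
  [/\ [/\ forall t, derivable phi t 1, forall t, derivable (derive1 phi) t 1 &
          continuous (derive1n 2 phi)],
      forall t, 0 < phi t < kappa,
      {homo phi : s t / s <= t},
      phi t @[t --> -oo] --> (0 : R) &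
      phi t @[t --> +oo] --> kappa].

Definition has_monotone_front f (kappa h c : R) nu : Prop :=
  exists phi : R -> R, front_profile kappa phi /\
    is_solution f h (fun t x => phi (dotv nu x + c * t)).

End Fronts.

(* Main.v *)
(** The profile equation [phi'' = c phi' - f (phi, phi (. - c h))] is studied
    through the speed [phi'] as a function of the position [phi].

    Existence.  For a given speed function the delayed value [phi (t - c h)] is
    the position reached after travelling backwards for the time [c h]; a
    larger speed yields a smaller delayed value, hence a larger reaction term
    since [f_2 <= 0].  The equation for the speed is therefore the fixed-point
    equation of an order-preserving integral operator.  It preserves the upper
    bounds [lambda x] (with [lambda ^ 2 - c lambda + alpha_0 = 0]) and
    [mu (kappa - x)] (with [- mu] a negative root of the characteristic
    equation at [kappa]), and a small multiple of [x (kappa - x)] as lower bound,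
    so the supremum of the subsolutions is a solution (Tarski).  The logistic
    coordinate [x = kappa e^s / (1 + e^s)] removes the singularities at [0] and
    [kappa].

    Necessity.  Near [-oo], [phi / phi'] has derivative at least
    [1 - c ^ 2 / (4 a)] for every [a < alpha_0], which is impossible for a
    positive function if [c ^ 2 < 4 alpha_0].  Near [+oo], the exponential decay
    rates of [kappa - phi] are bounded, and if the characteristic equation has no
    negative root then any rate can be improved beyond their supremum. *)

Require Import Defs.
From HB Require Import structures.
From mathcomp Require Import all_boot all_order all_algebra.
From mathcomp Require Import all_classical all_reals all_analysis.
From mathcomp Require Import ring lra.
Set Implicit Arguments.
Unset Strict Implicit.
Unset Printing Implicit Defensive.

Import Order.TTheory GRing.Theory Num.Theory.
Import numFieldNormedType.Exports.
Local Open Scope classical_set_scope.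
Local Open Scope ring_scope.

(** * Derivatives and antiderivatives of real functions *)

Section RealFunctions.
Context {R : realType}.
Implicit Types (F G dF f g w dw : R -> R) (a b x s K C l : R).

Lemma is_derive_fun_add f g x a b : is_derive x 1 f a -> is_derive x 1 g b ->
  is_derive x 1 (fun t => f t + g t) (a + b).
Proof. by move=> df dg; exact: is_deriveD. Qed.

Lemma is_derive_fun_opp f x a : is_derive x 1 f a ->
  is_derive x 1 (fun t => - f t) (- a).
Proof. by move=> df; exact: is_deriveN. Qed.

Lemma is_derive_fun_mul f g x a b : is_derive x 1 f a -> is_derive x 1 g b ->
  is_derive x 1 (fun t => f t * g t) (a * g x + f x * b).
Proof.
move=> df dg; apply: (is_derive_eq (is_deriveM df dg)).
by rewrite addrC /GRing.scale /= [g x * a]mulrC.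
Qed.

Lemma is_derive_fun_id x : is_derive x 1 (fun t : R => t) 1.
Proof. exact: is_derive_id. Qed.

Lemma is_derive_fun_cst a x : is_derive x 1 (fun _ : R => a) 0.
Proof. exact: is_derive_cst. Qed.

Lemma is_derive_fun_comp f g x a b : is_derive (g x) 1 f a ->
  is_derive x 1 g b -> is_derive x 1 (fun t => f (g t)) (a * b).
Proof. by move=> df dg; exact: is_derive1_comp. Qed.

Lemma is_derive_fun_expR g x a : is_derive x 1 g a ->
  is_derive x 1 (fun t => expR (g t)) (expR (g x) * a).
Proof. exact: is_derive_fun_comp. Qed.

Lemma is_derive_fun_lin a s x : is_derive x 1 (fun t => a * (t - s)) a.
Proof.
have D := is_derive_fun_mul (is_derive_fun_cst a x)
  (is_derive_fun_add (is_derive_fun_id x) (is_derive_fun_cst (- s) x)).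
by apply: is_derive_eq D _; rewrite mul0r add0r addr0 mulr1.
Qed.

Lemma is_derive_fun_exp_lin a s x :
  is_derive x 1 (fun t => expR (a * (t - s))) (expR (a * (x - s)) * a).
Proof. exact: is_derive_fun_expR (is_derive_fun_lin a s x). Qed.

Lemma is_derive_fun_inv f x a : f x != 0 -> is_derive x 1 f a ->
  is_derive x 1 (fun t => (f t)^-1) (- (a / f x ^+ 2)).
Proof.
move=> f0 df; apply: (is_derive_eq (is_deriveV f0 df)).
by rewrite /GRing.scale /= mulrC mulrN.
Qed.

Lemma is_derive_fun_shift f x s a : is_derive (x + s) 1 f a ->
  is_derive x 1 (fun t => f (t + s)) a.
Proof.
move=> df.
have ds := is_derive_fun_add (is_derive_fun_id x) (is_derive_fun_cst s x).
by apply: is_derive_eq (is_derive_fun_comp (g := fun t => t + s) df ds) _; rewrite addr0 mulr1.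
Qed.

Lemma is_derive_continuous F x l : is_derive x 1 F l -> {for x, continuous F}.
Proof. by case=> dF _; apply: differentiable_continuous; exact/derivable1_diffP. Qed.

Lemma mean_value F dF a b : a < b ->
  (forall x, a <= x <= b -> is_derive x 1 F (dF x)) ->
  exists2 x, a < x < b & F b - F a = dF x * (b - a).
Proof.
move=> ab HF; have [||x] := @MVT R F dF a b ab.
- by move=> x; rewrite in_itv /= => /andP[/ltW ax /ltW xb]; apply: HF; rewrite ax.
- apply: derivable_within_continuous => x; rewrite in_itv /= => xab.
  by have [] := HF _ xab.
- by rewrite in_itv; exists x.
Qed.

Lemma derive_ge0_ler F dF a b : a <= b ->
  (forall x, a <= x <= b -> is_derive x 1 F (dF x)) ->
  (forall x, a <= x <= b -> 0 <= dF x) -> F a <= F b.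
Proof.
rewrite le_eqVlt => /predU1P[->//|ab] HF dF0.
have [x /andP[/ltW ax /ltW xb] E] := mean_value ab HF.
by rewrite -subr_ge0 E mulr_ge0 ?dF0 ?ax// subr_ge0 ltW.
Qed.

Lemma derive_le0_ler F dF a b : a <= b ->
  (forall x, a <= x <= b -> is_derive x 1 F (dF x)) ->
  (forall x, a <= x <= b -> dF x <= 0) -> F b <= F a.
Proof.
move=> ab HF dF0; rewrite -lerN2.
apply: (@derive_ge0_ler (fun t => - F t) (fun t => - dF t)) => // x xab.
  exact: is_derive_fun_opp (HF _ xab).
by rewrite oppr_ge0 dF0.
Qed.

(* A negative value would be amplified like [expR (K * (s - s0))]. *)
Lemma bounded_growth_ge0 w dw K C (s0 : R) : 0 < K ->
  (forall s, s0 <= s -> is_derive s 1 w (dw s)) ->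
  (forall s, s0 <= s -> dw s <= K * w s) ->
  (forall s, s0 <= s -> - C <= w s) -> 0 <= w s0.
Proof.
move=> K0 Dw dwK wC; rewrite leNgt; apply/negP => w0.
have C0 : 0 < C by have := wC _ (lexx s0); lra.
have wn0 : w s0 != 0 by rewrite lt_eqF.
have Kn0 : K != 0 by rewrite gt_eqF.
pose s := s0 + (C / - w s0) / K.
have dsK : K * (s - s0) = C / - w s0 by rewrite /s; field; rewrite wn0 Kn0.
have Cw : 0 < C / - w s0 by rewrite divr_gt0// oppr_gt0.
have ss : s0 <= s by rewrite /s lerDl ltW// divr_gt0.
have : expR (- K * (s - s0)) * w s <= expR (- K * (s0 - s0)) * w s0.
  apply: (@derive_le0_ler (fun t => expR (- K * (t - s0)) * w t)
    (fun t => expR (- K * (t - s0)) * (dw t - K * w t))) => // t /andP[st _].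
    by apply: is_derive_eq (is_derive_fun_mul (is_derive_fun_exp_lin _ _ _) (Dw _ st)) _; ring.
  by rewrite pmulr_rle0 ?expR_gt0// subr_le0 dwK.
rewrite subrr mulr0 expR0 mul1r mulNr expRN.
rewrite mulrC ler_pdivrMr ?expR_gt0// dsK => h.
have := expR_ge1Dx (C / - w s0) => e1.
have : w s <= w s0 * (1 + C / - w s0).
  by apply: (le_trans h); rewrite ler_nM2l.
have -> : w s0 * (1 + C / - w s0) = w s0 - C by field.
by have := wC _ ss; lra.
Qed.

(** An integral from a fixed base point only controls points to its right, so the base point moves
    with [y]; normalizing at [0] makes the value independent of it. *)
Lemma continuous_antiderivative g : continuous g ->
  exists F, forall x, is_derive x 1 F (g x).
Proof.
move=> cg.
pose P a y := (\int[@lebesgue_measure R]_(t in [set` `[a, y]]) g t)%R.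
have dP a y : a < y -> is_derive y 1 (P a) (g y).
  move=> ay.
  have y1 : y < y + 1 by rewrite ltrDl.
  have ig : (@lebesgue_measure R).-integrable `[a, y + 1] (EFin \o g).
    apply: continuous_compact_integrable; first exact: segment_compact.
    exact: continuous_subspaceT.
  have [D <-] := continuous_FTC1_closed y1 ig ay (cg y).
  by rewrite derive1E; exact: derivableP.
have Pind a b y z : a < y -> b < y -> y <= z -> P a z - P a y = P b z - P b y.
  move=> ay by_ yz; suff -> : P a z = P b z + (P a y - P b y) by ring.
  have D t : y <= t <= z -> is_derive t 1 (fun t => P a t - P b t) 0.
    move=> /andP[yt _]; apply: is_derive_eq (subrr (g t)).
    apply: is_derive_fun_add; first by apply: dP; exact: lt_le_trans yt.
    by apply: is_derive_fun_opp; apply: dP; exact: lt_le_trans yt.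
  have h1 := @derive_ge0_ler _ _ _ _ yz D (fun _ _ => lexx 0).
  have h2 := @derive_le0_ler _ _ _ _ yz D (fun _ _ => lexx 0).
  by move: h1 h2; lra.
have {}Pind a b y z : a < y -> b < y -> a < z -> b < z ->
    P a z - P a y = P b z - P b y.
  move=> ay by_ az bz; case: (leP y z) => [yz|/ltW zy]; first exact: Pind.
  by rewrite -opprB (Pind _ b)// opprB.
exists (fun y => P (- (`|y| + 1)) y - P (- (`|y| + 1)) 0) => x.
pose A : R := - (`|x| + 2).
have lo (y : R) : - (`|y| + 1) < y /\ - (`|y| + 1) < 0.
  by have := ler_norm (- y); rewrite normrN; have := normr_ge0 y; lra.
have Ax : A < x by have := ler_norm (- x); rewrite normrN /A; lra.
have A0 : A < 0 by have := normr_ge0 x; rewrite /A; lra.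
apply: (@near_eq_is_derive _ _ _ (fun y => P A y - P A 0)).
- near=> y; have [? ?] := lo y; apply: Pind => //.
  by near: y; exact: lt_nbhsr.
- by apply: is_derive_eq; [exact: is_derive_fun_add (dP _ _ Ax) (is_derive_fun_cst _ _)|rewrite addr0].
Unshelve. all: by end_near. Qed.

End RealFunctions.

(** * Bounded solutions of a linear equation, and travel time along a speed field *)

Section LinearAndFlow.
Context {R : realType}.
Implicit Types (N rho H Hi : R -> R) (K C nu M s t : R).

(** The solution is [e^(K s)] times the integral of [e^(- K u) N u] over [u >= s], the one that does
    not blow up at [+oo]; bounding [N] by [C] there gives [C / K]. *)
Lemma bounded_linear_solution N K C : 0 < K -> continuous N ->
  (forall s, 0 <= N s <= C) ->
  exists r : R -> R, (forall s, is_derive s 1 r (K * r s - N s)) /\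
    (forall s, 0 <= r s <= C / K).
Proof.
move=> K0 cN NC.
pose e (a s : R) := expR (a * (s - 0)).
have De a s : is_derive s 1 (e a) (e a s * a) by exact: is_derive_fun_exp_lin.
have e0 a s : 0 < e a s by exact: expR_gt0.
have eNe s : e K s * e (- K) s = 1.
  by rewrite /e -expRD -mulrDl subrr mul0r expR0.
have [F DF] : exists F, forall s, is_derive s 1 F (e (- K) s * N s).
  apply: continuous_antiderivative => s; apply: continuousM (cN s).
  exact: is_derive_continuous (De _ _).
have Fle s t : s <= t -> F s <= F t.
  move=> st; apply: (derive_ge0_ler st (fun s _ => DF s)) => u _.
  by rewrite mulr_ge0 ?(ltW (e0 _ _))//; case/andP: (NC u).
have FCle s t : F t <= F s + C / K * e (- K) s.
  have C0 : 0 <= C by have /andP[/le_trans/[apply]] := NC 0.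
  case: (leP t s) => [/Fle/le_trans->//|/ltW st].
    by rewrite lerDl mulr_ge0 ?divr_ge0 ?(ltW K0) ?(ltW (e0 _ _)).
  have D u := is_derive_fun_add (DF u)
    (is_derive_fun_mul (is_derive_fun_cst (C / K) u) (De (- K) u)).
  have := derive_le0_ler st (fun u _ => D u).
  suff H u : e (- K) u * N u +
      (0 * e (- K) u + C / K * (e (- K) u * - K)) <= 0.
    move=> /(_ (fun u _ => H u)); apply: le_trans.
    by rewrite lerDl mulr_ge0 ?divr_ge0 ?(ltW K0) ?(ltW (e0 _ _)).
  have -> : e (- K) u * N u + (0 * e (- K) u + C / K * (e (- K) u * - K)) =
      e (- K) u * (N u - C) by field; rewrite gt_eqF.
  by rewrite pmulr_rle0// subr_le0; case/andP: (NC u).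
(* [F] is nondecreasing and bounded above, so [I] is its limit at [+oo] and [I - F s] is the tail
   integral. *)
pose I := sup (range F).
have hI : has_ubound (range F).
  by exists (F 0 + C / K * e (- K) 0) => _ [t _ <-].
have FI s : F s <= I by apply: ub_le_sup => //; exists s.
have IF s : I <= F s + C / K * e (- K) s.
  by apply: ge_sup => [|_ [t _ <-]//]; exists (F 0); exists 0.
exists (fun s => e K s * (I - F s)); split => s.
  apply: is_derive_eq (is_derive_fun_mul (De K s)
    (is_derive_fun_add (is_derive_fun_cst I s) (is_derive_fun_opp (DF s)))) _.
  by rewrite -[N s in RHS]mul1r -(eNe s); ring.
apply/andP; split; first by rewrite mulr_ge0 ?(ltW (e0 _ _))// subr_ge0.
have -> : C / K = e K s * (C / K * e (- K) s).
  by rewrite mulrCA eNe mulr1.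
by rewrite ler_pM2l// lerBlDl.
Qed.

(** [H s] is the time at which the flow [ds/dt = rho s] reaches [s], and [Hi] is the trajectory. The
    upper bound [M] keeps the slope of [H] at least [1 / M], which makes [H] onto. *)
Lemma travel_time rho nu M : 0 < nu -> continuous rho ->
  (forall s, nu <= rho s <= M) ->
  exists H Hi, [/\ forall s, is_derive s 1 H (rho s)^-1, cancel H Hi,
    cancel Hi H & forall t, is_derive t 1 Hi (rho (Hi t))].
Proof.
move=> nu0 crho rhoM.
have rho0 s : 0 < rho s by case/andP: (rhoM s) => + _; exact: lt_le_trans.
have M0 : 0 < M by case/andP: (rhoM 0) => _; exact: lt_le_trans.
have [H DH] : exists H, forall s, is_derive s 1 H (rho s)^-1.
  apply: continuous_antiderivative => s.
  by apply: continuousV; [rewrite gt_eqF|exact: crho].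
have Hgrow s t : s <= t -> (t - s) / M <= H t - H s.
  move=> st.
  have D u := is_derive_fun_add (DH u) (is_derive_fun_opp (is_derive_fun_lin M^-1 0 u)).
  have := derive_ge0_ler st (fun u _ => D u).
  suff P u : 0 <= (rho u)^-1 - M^-1.
    by move=> /(_ (fun u _ => P u)) /=; rewrite !subr0 mulrBl -[_ / M]mulrC -[s / M]mulrC; lra.
  by rewrite subr_ge0 lef_pV2 ?posrE//; case/andP: (rhoM u).
have Hinj : injective H.
  move=> s t E; apply/eqP; rewrite eq_le; apply/andP; split; rewrite leNgt; apply/negP => st.
    have := Hgrow _ _ (ltW st); rewrite E subrr leNgt => /negP; apply.
    by rewrite divr_gt0// subr_gt0.
  have := Hgrow _ _ (ltW st); rewrite E subrr leNgt => /negP; apply.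
  by rewrite divr_gt0// subr_gt0.
have cH : continuous H by move=> s; exact: is_derive_continuous (DH s).
have Hsurj t : exists s, H s = t.
  pose a := M * `|t - H 0|.
  have a0 : 0 <= a by rewrite mulr_ge0// ltW.
  have aM : a / M = `|t - H 0| by rewrite /a mulrC mulKf// gt_eqF.
  have Na : - a <= a by lra.
  have h1 : H (- a) <= t.
    have Na0 : - a <= 0 by lra.
    have := Hgrow _ _ Na0; rewrite sub0r opprK aM => h1.
    have := ler_norm (- (t - H 0)); rewrite normrN; lra.
  have h2 : t <= H a.
    have := Hgrow _ _ a0; rewrite subr0 aM => h2.
    have := ler_norm (t - H 0); lra.
  have [|s _ <-] := @IVT R H (- a) a t Na (continuous_subspaceT cH); last by exists s.
  by rewrite ge_min h1 le_max h2 orbT.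
have [Hi HiK] := choice Hsurj.
have HK : cancel H Hi by move=> s; apply: Hinj; rewrite HiK.
exists H, Hi; split => // t.
rewrite -{1}(HiK t) -[rho (Hi t)]invrK.
apply: (is_derive_inverse _ _ (DH _)); last by rewrite invr_eq0 gt_eqF.
- by near=> x; exact: HK.
- by near=> x; exact: cH.
Unshelve. all: by end_near. Qed.

End LinearAndFlow.

(** * Existence of monotone profiles *)

(** The shift [K] compensates the decreasing term [g / r], whose slope is at least [- Gm / nu ^ 2]
    for [r >= nu]; the extra [1] covers [th >= -1]. *)
Lemma monotone_rhs {R : realFieldType} (K nu Gm th g1 g2 r1 r2 : R) :
  0 < nu -> nu <= r1 -> r1 <= r2 -> g1 <= g2 -> 0 <= g2 <= Gm -> -1 <= th ->
  1 + Gm / nu ^+ 2 <= K ->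
  g1 / r1 + (K + th) * r1 <= g2 / r2 + (K + th) * r2.
Proof.
move=> nu0 nur1 r12 g12 /andP[g20 g2m] th1 HK.
have r10 : 0 < r1 by exact: lt_le_trans nur1.
have r20 : 0 < r2 by exact: lt_le_trans r12.
have h1 : g1 / r1 <= g2 / r1 by rewrite ler_pM2r// invr_gt0.
have h2 : g2 / r1 - g2 / r2 <= Gm / nu ^+ 2 * (r2 - r1).
  have -> : g2 / r1 - g2 / r2 = g2 / (r1 * r2) * (r2 - r1).
    by field; rewrite !gt_eqF.
  rewrite ler_wpM2r ?subr_ge0//.
  have nu2 : 0 < nu ^+ 2 by rewrite exprn_gt0.
  have nur : nu ^+ 2 <= r1 * r2.
    by rewrite expr2 ler_pM ?(ltW nu0)// (le_trans nur1).
  apply: ler_pM => //; first by rewrite invr_ge0 mulr_ge0// ltW.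
  by rewrite lef_pV2 ?posrE// mulr_gt0.
have h3 : Gm / nu ^+ 2 * (r2 - r1) <= (K + th) * (r2 - r1).
  by rewrite ler_wpM2r ?subr_ge0//; lra.
by rewrite mulrBr in h3; lra.
Qed.

(** * The logistic coordinate on the interval from [0] to [kappa] *)

Section LogisticCoordinate.
Context {R : realType}.
Variable kappa : R.
Hypothesis kappa0 : 0 < kappa.
Implicit Types s t : R.

Definition logistic s := kappa * (1 - (1 + expR s)^-1).
Definition logistic_slope s := kappa * (expR s * (1 + expR s)^-1 * (1 + expR s)^-1).
(** The logarithmic derivative of [logistic_slope]: along [x = logistic s] one has [x'' =
    logistic_slope s * (s'' + logistic_bend s * s' ^ 2)]. *)
Definition logistic_bend s := (1 - expR s) / (1 + expR s).

Lemma expR1_gt0 s : 0 < 1 + expR s.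
Proof. by rewrite addr_gt0 ?expR_gt0. Qed.

Let e1 := expR1_gt0.
Let e1n s : 1 + expR s != 0. Proof. by rewrite gt_eqF. Qed.
Let en s : expR s != 0. Proof. by rewrite gt_eqF ?expR_gt0. Qed.

Lemma logistic_itv s : 0 < logistic s < kappa.
Proof.
have i0 : 0 < (1 + expR s)^-1 by rewrite invr_gt0.
have i1 : (1 + expR s)^-1 < 1 by rewrite invf_lt1// ltrDl expR_gt0.
by rewrite /logistic mulr_gt0 ?subr_gt0//= -[ltRHS]mulr1 ltr_pM2l//.
Qed.

Lemma logistic_le s t : s <= t -> logistic s <= logistic t.
Proof.
by move=> st; rewrite /logistic ler_pM2l// lerD2l lerN2 lef_pV2 ?posrE// lerD2l ler_expR.
Qed.

Lemma logistic_slope_gt0 s : 0 < logistic_slope s.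
Proof. by rewrite /logistic_slope !mulr_gt0 ?expR_gt0 ?invr_gt0. Qed.

Lemma logistic_bend_itv s : -1 <= logistic_bend s <= 1.
Proof.
by rewrite /logistic_bend ler_pdivlMr// ler_pdivrMr//; have := expR_gt0 s; lra.
Qed.

Let Dinv s : is_derive s 1 (fun t => (1 + expR t)^-1) (- (expR s / (1 + expR s) ^+ 2)).
Proof.
apply: (is_derive_fun_inv (f := fun t => 1 + expR t) (e1n s)).
rewrite -[X in is_derive _ _ _ X]add0r.
exact: is_derive_fun_add (is_derive_fun_cst _ _) (is_derive_expR _).
Qed.

Lemma is_derive_logistic s : is_derive s 1 logistic (logistic_slope s).
Proof.
have D := is_derive_fun_mul (is_derive_fun_cst kappa s)
  (is_derive_fun_add (is_derive_fun_cst 1 s) (is_derive_fun_opp (Dinv s))).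
by apply: is_derive_eq D _; rewrite /logistic_slope; field; rewrite e1n.
Qed.

Lemma is_derive_logistic_slope s :
  is_derive s 1 logistic_slope (logistic_slope s * logistic_bend s).
Proof.
have D := is_derive_fun_mul (is_derive_fun_cst kappa s)
  (is_derive_fun_mul (is_derive_fun_mul (is_derive_expR s) (Dinv s)) (Dinv s)).
apply: is_derive_eq D _; rewrite /logistic_slope /logistic_bend.
by field; rewrite e1n.
Qed.

Lemma logistic_bendE s : logistic_bend s = 2 * (1 + expR s)^-1 - 1.
Proof. by rewrite /logistic_bend; field; rewrite e1n. Qed.

Lemma continuous_logistic_bend : continuous logistic_bend.
Proof.
have -> : logistic_bend = fun t => 2 * (1 + expR t)^-1 + (- 1).
  by apply/funext => t; rewrite logistic_bendE.
move=> s; exact: is_derive_continuous (is_derive_fun_add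
  (is_derive_fun_mul (is_derive_fun_cst 2 s) (Dinv s)) (is_derive_fun_cst _ _)).
Qed.

(** Since [x' = logistic_slope s * s'], this identity turns [x' <= lam * x] into
    [s' <= lam * (1 + e^s)]; [logistic_complE] does the same for [mu * (kappa - x)] with
    [e^(-s)]. *)
Lemma logisticE s : logistic s = logistic_slope s * (1 + expR s).
Proof. by rewrite /logistic /logistic_slope; field; rewrite e1n. Qed.

Lemma logistic_compl s : kappa - logistic s = kappa / (1 + expR s).
Proof. by rewrite /logistic; field; rewrite e1n. Qed.

Lemma logistic_complE s : kappa - logistic s = logistic_slope s * (1 + (expR s)^-1).
Proof. by rewrite /logistic /logistic_slope; field; rewrite e1n en. Qed.

Lemma logistic_mul_compl s : logistic s * (kappa - logistic s) = kappa * logistic_slope s.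
Proof. by rewrite /logistic /logistic_slope; field; rewrite e1n. Qed.

End LogisticCoordinate.

(** * The speed equation as a monotone fixed-point problem *)

Section SlowestSpeed.
Context {R : realType}.
Variables (f : R * R -> R) (kappa al b c tau lam mu k : R).
Implicit Types (x y z s t q : R) (rho H sig : R -> R).
Hypotheses (kappa0 : 0 < kappa) (tau0 : 0 <= tau) (lam0 : 0 < lam) (mu0 : 0 < mu)
  (k0 : 0 < k) (al0 : 0 < al) (c0 : 0 < c) (f_cont : continuous f).
Hypothesis f_gt0 : forall x y, 0 < x < kappa -> 0 < y < kappa -> 0 < f (x, y).
Hypothesis f_le_l : forall x y, 0 < x < kappa -> 0 < y < kappa -> f (x, y) <= al * x.
Hypothesis f_le_r : forall x y, 0 < x < kappa -> 0 < y < kappa ->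
  f (x, y) <= b * (kappa - y).
Hypothesis f_decr : forall x y z, 0 < x < kappa -> 0 < y < kappa -> 0 < z < kappa ->
  y <= z -> f (x, z) <= f (x, y).
Hypothesis f_diag : forall x, 0 < x < kappa -> k * (x * (kappa - x)) <= f (x, x).
Hypothesis lamE : lam ^+ 2 - c * lam + al = 0.
Hypothesis muE : mu ^+ 2 + c * mu = b * expR (mu * tau).

Let xs := logistic kappa.
Let om := logistic_slope kappa.
Let th : R -> R := logistic_bend.
Let om0 := logistic_slope_gt0 kappa0.
Let xsI := logistic_itv kappa0.

(** Here [q] is the coordinate of the delayed position. For the speed [rho] the profile equation
    reads [rho' = c - th * rho - reaction / rho]. *)
Let reaction s q : R := f (xs s, xs q) / om s.

(** [Gm], [M] and [C] will bound the delayed reaction, the admissible speeds and [rhs]; [K] is the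
    shift of [monotone_rhs]. The constant speed [nu] corresponds to
    [x' = nu / kappa * x * (kappa - x)] and is small enough to be a subsolution ([nu_k]) below both
    upper barriers. *)
Let b1 := mu ^+ 2 + c * mu.
Let Gm := 2 * (al + b1).
Let nu := Num.min (Num.min lam mu) (Num.min 1 (k * kappa / (c + 1))).
Let K := 1 + Gm / nu ^+ 2.
Let M := 2 * (lam + mu).
Let C := Gm / nu + (K + 1) * M.

Let b10 : 0 < b1.
Proof. by apply: addr_gt0; [exact: exprn_gt0|exact: mulr_gt0]. Qed.
Let Gm0 : 0 < Gm. Proof. by apply: mulr_gt0 => //; exact: addr_gt0. Qed.
Let c10 : 0 < c + 1. Proof. by rewrite addr_gt0. Qed.
Let nu0 : 0 < nu.
Proof. by rewrite /nu !lt_min lam0 mu0 ltr01 divr_gt0 ?mulr_gt0. Qed.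
Let nu_lam : nu <= lam. Proof. by rewrite /nu !ge_min lexx. Qed.
Let nu_mu : nu <= mu. Proof. by rewrite /nu !ge_min lexx !orbT. Qed.
Let nu_1 : nu <= 1. Proof. by rewrite /nu !ge_min lexx !orbT. Qed.
Let nu_k : nu * (c + nu) <= k * kappa.
Proof.
have h : nu * (c + 1) <= k * kappa.
  by rewrite -ler_pdivlMr// /nu !ge_min lexx !orbT.
by apply: le_trans h; rewrite ler_pM2l// lerD2l.
Qed.
Let K1 : 1 <= K. Proof. by rewrite /K lerDl divr_ge0 ?exprn_ge0 ?ltW. Qed.
Let K0 : 0 < K. Proof. exact: lt_le_trans K1. Qed.
Let M0 : 0 < M. Proof. by apply: mulr_gt0 => //; exact: addr_gt0. Qed.
Let C0 : 0 < C.
Proof. by apply: addr_gt0; [exact: divr_gt0|apply: mulr_gt0 => //; exact: addr_gt0]. Qed.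

(* [rho] is the speed [ds/dt] of a profile in the coordinate [s]. *)
Definition admissible_speed (rho : R -> R) : Prop :=
  [/\ forall s, nu <= rho s, forall s, rho s <= lam * (1 + expR s),
      forall s, rho s <= mu * (1 + (expR s)^-1) &
      forall s t, s <= t -> `|rho t - rho s| <= 2 * C * (t - s)].

(** The speed equation is [rho' = K * rho - rhs rho]; the term [K * r] is added so that [rhs]
    increases with [r]. *)
Let rhs r s q := reaction s q / r + (K + th s) * r - c.

(** One step of the iteration, as a relation: [H] is travel time under [rho], [sig s] the position a
    time [tau] earlier, and [r] solves the linear equation driven by [rho]. Among admissible speeds
    [next_speed_mono] makes [r] unique. *)
Definition next_speed (rho r : R -> R) : Prop :=
  exists H sig, [/\ forall s, is_derive s 1 H (rho s)^-1,
    forall s, H (sig s) = H s - tau &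
    forall s, is_derive s 1 r (K * r s - rhs (rho s) s (sig s))].

Let adm_gt0 rho : admissible_speed rho -> forall s, 0 < rho s.
Proof. by move=> [h _ _ _] s; exact: lt_le_trans (h s). Qed.

Let adm_M rho : admissible_speed rho -> forall s, rho s <= M.
Proof.
move=> [_ h1 h2 _] s; have e0 := expR_gt0 s.
case: (leP (expR s) 1) => es.
  apply: (le_trans (h1 s)); rewrite /M [2 * _]mulrC.
  by apply: ler_pM; rewrite ?(ltW lam0)//; move: mu0; lra.
apply: (le_trans (h2 s)); rewrite /M [2 * _]mulrC.
have ei : (expR s)^-1 <= 1 by rewrite invf_le1// ltW.
have ei0 : 0 < (expR s)^-1 by rewrite invr_gt0.
by apply: ler_pM; rewrite ?(ltW mu0)//; move: lam0; lra.
Qed.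

Let adm_cont rho : admissible_speed rho -> continuous rho.
Proof.
move=> [_ _ _ h] s.
have h' t : `|rho s - rho t| <= 2 * C * `|s - t|.
  case: (leP s t) => [st|/ltW ts].
    by rewrite distrC (distrC s) (le_trans (h _ _ st))// ger0_norm ?subr_ge0.
  by rewrite (le_trans (h _ _ ts))// ger0_norm ?subr_ge0.
apply/cvgrPdist_lt => e e0; near=> t.
apply: (le_lt_trans (h' t)); rewrite mulrC -ltr_pdivlMr ?mulr_gt0//.
near: t; apply: cvgr_dist_lt; first exact: cvg_id.
by rewrite divr_gt0 ?mulr_gt0.
Unshelve. all: by end_near. Qed.

Let reaction_gt0 s q : 0 < reaction s q.
Proof. by rewrite divr_gt0// f_gt0 ?xsI. Qed.

Let reaction_le_al s q : reaction s q <= al * (1 + expR s).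
Proof.
rewrite ler_pdivrMr// -mulrA [_ * om s]mulrC -logisticE//.
exact: f_le_l.
Qed.

Let delay_le rho H s q : admissible_speed rho ->
  (forall s, is_derive s 1 H (rho s)^-1) -> H q = H s - tau -> q <= s.
Proof.
move=> arho DH Hq; rewrite leNgt; apply/negP => sq.
have [x _ E] := mean_value sq (fun t _ => DH t).
have : 0 < (rho x)^-1 * (q - s).
  by rewrite mulr_gt0 ?subr_gt0// invr_gt0 (adm_gt0 arho).
by rewrite -E Hq; move: tau0; lra.
Qed.

(* Along the slow profile [kappa - x] decays at rate at most [mu]. *)
Let reaction_le_mu rho H s q : admissible_speed rho ->
  (forall s, is_derive s 1 H (rho s)^-1) -> H q = H s - tau ->
  reaction s q <= b1 * (1 + (expR s)^-1).
Proof.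
move=> arho DH Hq.
have qs := delay_le arho DH Hq.
have D t := is_derive_fun_mul
  (is_derive_fun_expR (is_derive_fun_mul (is_derive_fun_cst (- mu) t) (DH t)))
  (is_derive_fun_add (is_derive_fun_cst 1 t) (is_derive_expR t)).
have := derive_le0_ler qs (fun t _ => D t).
set dD := (X in (forall t, _ -> X t <= 0) -> _).
have dDle t : q <= t <= s -> dD t <= 0.
  move=> _; rewrite /dD.
  have -> : expR (- mu * H t) * (0 * H t + - mu * (rho t)^-1) * (1 + expR t) +
      expR (- mu * H t) * (0 + expR t) =
    expR (- mu * H t) * (expR t / rho t * (rho t - mu * (1 + (expR t)^-1))).
    by field; rewrite !gt_eqF ?expR_gt0// (adm_gt0 arho).
  rewrite pmulr_rle0 ?expR_gt0// pmulr_rle0; first by case: arho => _ _ h _; rewrite subr_le0.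
  by rewrite divr_gt0 ?expR_gt0// (adm_gt0 arho).
move=> /(_ dDle) hle.
have {}hle : 1 + expR s <= expR (mu * tau) * (1 + expR q).
  have E : - mu * H q = mu * tau + - mu * H s by rewrite Hq; ring.
  move: hle; rewrite E expRD -mulrA [X in _ <= X]mulrCA.
  by rewrite ler_pM2l ?expR_gt0.
rewrite ler_pdivrMr// -mulrA [_ * om s]mulrC -logistic_complE//.
apply: (le_trans (f_le_r (xsI s) (xsI q))).
(* During the delay [1 + e^s = kappa / (kappa - x)] grows at most by the factor [e^(mu tau)], and
   [muE] says that [b] times this factor is [b1]. *)
rewrite /b1 muE -mulrA.
have b0 : 0 < b.
  by move: b10; rewrite /b1 muE pmulr_lgt0// expR_gt0.
rewrite ler_pM2l// !logistic_compl// mulrCA ler_pM2l//.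
rewrite ler_pdivlMr ?expR1_gt0// mulrC.
by rewrite -ler_pdivlMr ?invr_gt0 ?expR1_gt0// invrK.
Qed.

Let reaction_le rho H s q : admissible_speed rho ->
  (forall s, is_derive s 1 H (rho s)^-1) -> H q = H s - tau ->
  reaction s q <= Gm.
Proof.
move=> arho DH Hq; have e0 := expR_gt0 s; rewrite /Gm [2 * _]mulrC.
case: (leP (expR s) 1) => es.
  apply: (le_trans (reaction_le_al s q)).
  by apply: ler_pM; rewrite ?(ltW al0)//; move: b10; lra.
apply: (le_trans (reaction_le_mu arho DH Hq)).
have ei : (expR s)^-1 <= 1 by rewrite invf_le1// ltW.
have ei0 : 0 < (expR s)^-1 by rewrite invr_gt0.
by apply: ler_pM; rewrite ?(ltW b10)//; move: al0; lra.
Qed.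

(** The delayed argument lies to the left, where [f] is at least as large as on the diagonal. *)
Let reaction_ge s q : q <= s -> k * kappa <= reaction s q.
Proof.
move=> qs; rewrite ler_pdivlMr// -mulrA -logistic_mul_compl//.
apply: (le_trans (f_diag (xsI s))); apply: f_decr => //; exact: logistic_le.
Qed.

Let rhs_mono s r1 r2 q1 q2 : nu <= r1 -> r1 <= r2 ->
  reaction s q1 <= reaction s q2 -> reaction s q2 <= Gm ->
  rhs r1 s q1 <= rhs r2 s q2.
Proof.
move=> h1 h2 h3 h4; rewrite /rhs lerD2r.
apply: (@monotone_rhs R K nu Gm) => //; first by rewrite ltW.
by case/andP: (logistic_bend_itv s).
Qed.

(** The constant [nu] is a subsolution: [k * kappa / nu >= c + nu] pays both for [c] and for the
    bend, which is at worst [-1]. *)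
Let next_speed_ge rho H sig : admissible_speed rho ->
  (forall s, is_derive s 1 H (rho s)^-1) -> (forall s, H (sig s) = H s - tau) ->
  forall s, K * nu <= rhs (rho s) s (sig s).
Proof.
move=> arho DH Hs s.
have h1 := reaction_ge (delay_le arho DH (Hs s)).
have [nur _ _ _] := arho.
have h2 := @monotone_rhs R K nu Gm (th s) (k * kappa) (reaction s (sig s)) nu (rho s)
  nu0 (lexx _) (nur s) h1.
have {}h2 : k * kappa / nu + (K + th s) * nu <= reaction s (sig s) / rho s + (K + th s) * rho s.
  apply: h2 => //; first by rewrite (ltW (reaction_gt0 _ _)) (reaction_le arho DH (Hs s)).
  by case/andP: (logistic_bend_itv s).
have h3 : c + nu <= k * kappa / nu by rewrite ler_pdivlMr// mulrC nu_k.
have h4 : - nu <= th s * nu.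
  by rewrite -mulN1r ler_pM2r//; case/andP: (logistic_bend_itv s).
by rewrite /rhs; rewrite mulrDl in h2 *; lra.
Qed.

Let next_speed_le rho H sig : admissible_speed rho ->
  (forall s, is_derive s 1 H (rho s)^-1) -> (forall s, H (sig s) = H s - tau) ->
  forall s, rhs (rho s) s (sig s) <= C.
Proof.
move=> arho DH Hs s; rewrite /rhs /C.
have r0 := adm_gt0 arho s.
have h1 : reaction s (sig s) / rho s <= Gm / nu.
  apply: ler_pM; rewrite ?invr_ge0 ?(ltW r0) ?(ltW (reaction_gt0 _ _))//.
    exact: reaction_le arho DH (Hs s).
  by rewrite lef_pV2 ?posrE//; case: arho.
have h2 : (K + th s) * rho s <= (K + 1) * M.
  have /andP[t1 t2] := logistic_bend_itv s.
  apply: ler_pM; [|exact: ltW|by rewrite lerD2l|exact: adm_M].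
  by move: K1; rewrite -/(th s) in t1; lra.
by move: c0; lra.
Qed.

(** A negative value of [hi - lo] would be amplified at rate [K] past the lower bound [- D];
    boundedness takes the place of data at an endpoint. *)
Let compare (lo hi dlo dhi : R -> R) (D : R) : (forall s, lo s - hi s <= D) ->
  (forall s, is_derive s 1 lo (dlo s)) -> (forall s, is_derive s 1 hi (dhi s)) ->
  (forall s, dhi s - dlo s <= K * (hi s - lo s)) -> forall s, lo s <= hi s.
Proof.
move=> dD Dlo Dhi dK s; rewrite -subr_ge0.
apply: (bounded_growth_ge0 (w := fun t => hi t - lo t)
  (dw := fun t => dhi t - dlo t) (C := D) K0) => t _.
- exact: dK.
- by have := dD t; lra.
Qed.

Let next_speed_mono rho1 rho2 r1 r2 : admissible_speed rho1 -> admissible_speed rho2 ->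
  admissible_speed r1 -> admissible_speed r2 ->
  next_speed rho1 r1 -> next_speed rho2 r2 ->
  (forall s, rho1 s <= rho2 s) -> forall s, r1 s <= r2 s.
Proof.
move=> a1 a2 b1' b2' [H1 [q1 [DH1 Hq1 D1]]] [H2 [q2 [DH2 Hq2 D2]]] r12.
(* The slower speed [rho1] takes longer over the same stretch, so it needs at least [tau] from
   [q2 s] to [s]. *)
have q21 s : q2 s <= q1 s.
  have q2s := delay_le a2 DH2 (Hq2 s).
  have D t := is_derive_fun_add (DH1 t) (is_derive_fun_opp (DH2 t)).
  have h : H1 (q2 s) - H2 (q2 s) <= H1 s - H2 s.
    apply: (derive_ge0_ler q2s (fun t _ => D t)) => t _.
    by rewrite subr_ge0 lef_pV2 ?posrE ?(adm_gt0 a1) ?(adm_gt0 a2).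
  rewrite leNgt; apply/negP => q12.
  have [x _ E] := mean_value q12 (fun t _ => DH1 t).
  have : 0 < (rho1 x)^-1 * (q2 s - q1 s).
    by rewrite mulr_gt0 ?subr_gt0// invr_gt0 (adm_gt0 a1).
  by rewrite -E; have := Hq1 s; have := Hq2 s; lra.
apply: (compare (D := M) _ D1 D2) => s.
  by have := adm_M b1' s; have := adm_gt0 b2' s; lra.
suff : rhs (rho1 s) s (q1 s) <= rhs (rho2 s) s (q2 s) by rewrite mulrBr; lra.
apply: rhs_mono => //; first by case: a1.
  rewrite ler_pM2r ?invr_gt0//; apply: f_decr => //; exact: logistic_le.
exact: reaction_le a2 DH2 (Hq2 s).
Qed.

(** The bounded solution of the linear equation is compared with the three barriers; the Lipschitz
    bound holds since [K * r] and [N] both lie in [[0, C]]. *)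
Let next_speed_exists rho : admissible_speed rho ->
  exists2 r, admissible_speed r & next_speed rho r.
Proof.
move=> arho; have [nur rl rm rL] := arho; have r0 := adm_gt0 arho.
have [H [Hi [DH HK HiK DHi]]] : exists H Hi, [/\ forall s, is_derive s 1 H (rho s)^-1,
    cancel H Hi, cancel Hi H & forall t, is_derive t 1 Hi (rho (Hi t))].
  apply: (@travel_time R rho nu M nu0 (adm_cont arho)) => s.
  by rewrite nur adm_M.
pose sig s := Hi (H s - tau).
have Hsig s : H (sig s) = H s - tau by rewrite /sig HiK.
pose N s := rhs (rho s) s (sig s).
have csig : continuous sig.
  move=> s.
  have D := is_derive_fun_add (DH s) (is_derive_fun_opp (is_derive_fun_cst tau s)).
  exact: is_derive_continuous (is_derive_fun_comp (g := fun t => H t - tau) (DHi _) D).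
have cxs : continuous xs by move=> s; exact: is_derive_continuous (is_derive_logistic _ _).
have cN : continuous N.
  move=> s; have crho := adm_cont arho (x := s).
  have cpair : {for s, continuous (fun t => (xs t, xs (sig t)))}.
    exact: (@cvg_pair _ _ _ (nbhs s) (nbhs (xs s)) (nbhs (xs (sig s))) _ _ _ xs
      (xs \o sig) (cxs s) (continuous_comp (csig s) (cxs _))).
  have cf : {for s, continuous (fun t => f (xs t, xs (sig t)))}.
    exact: (continuous_comp (g := f) cpair (@f_cont _)).
  have com : {for s, continuous (fun t => (om t)^-1)}.
    apply: continuousV; first by rewrite gt_eqF.
    exact: is_derive_continuous (is_derive_logistic_slope _ _).
  have cri : {for s, continuous (fun t => (rho t)^-1)}.
    by apply: continuousV; [rewrite gt_eqF|exact: crho].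
  have cK : {for s, continuous (fun t => K + th t)}.
    exact: (continuousD (@cst_continuous _ _ K s) (@continuous_logistic_bend _ s)).
  exact: (continuousB (continuousD (continuousM (continuousM cf com) cri)
    (continuousM cK crho)) (@cst_continuous _ _ c s)).
have Knu0 : 0 < K * nu by rewrite mulr_gt0.
have NK s : K * nu <= N s by exact: next_speed_ge.
have NC s : N s <= C by exact: next_speed_le.
have N0C s : 0 <= N s <= C by rewrite NC (le_trans _ (NK s))// ltW.
have [r [Dr rC]] := bounded_linear_solution K0 cN N0C.
exists r; last by exists H, sig.
have rub s : r s <= C / K by case/andP: (rC s).
have rhs_le s rbar g : rho s <= rbar -> reaction s (sig s) <= g ->
    N s <= g / rbar + (K + th s) * rbar - c.
  move=> h1 h2; rewrite /N; have rb0 : 0 < rbar by exact: lt_le_trans (r0 s) h1.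
  apply: (@le_trans _ _ (rhs rbar s (sig s))).
    by apply: rhs_mono => //; exact: reaction_le arho DH (Hsig s).
  by rewrite /rhs !lerD2r ler_pM2r// invr_gt0.
have DE s := is_derive_fun_add (is_derive_fun_cst 1 s) (is_derive_expR s).
have DEi s : is_derive s 1 (fun t => 1 + (expR t)^-1) (- (expR s)^-1).
  have D := is_derive_fun_add (is_derive_fun_cst 1 s)
    (is_derive_fun_inv (f := expR) (lt0r_neq0 (expR_gt0 s)) (is_derive_expR s)).
  by apply: is_derive_eq D _; field; rewrite gt_eqF ?expR_gt0.
have rge0 s : 0 <= r s by case/andP: (rC s).
split.
- apply: (compare (lo := fun _ => nu) (D := nu) _ (fun s => is_derive_fun_cst nu s) Dr) => s.
    by have := rge0 s; lra.
  by rewrite mulrBr; have := NK s; lra.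
- have D s := is_derive_fun_mul (is_derive_fun_cst lam s) (DE s).
  apply: (compare (D := C / K) _ Dr D) => s.
    have : 0 <= lam * (1 + expR s) by rewrite mulr_ge0 ?(ltW lam0)// ltW// expR1_gt0.
    by have := rub s; lra.
  (* With the reaction replaced by its bound [al * (1 + e^s)], [lamE] makes [lam * (1 + e^s)] an
     exact solution of the speed equation. *)
  have := rhs_le s _ _ (rl s) (reaction_le_al s (sig s)).
  have -> : al * (1 + expR s) / (lam * (1 + expR s)) + (K + th s) * (lam * (1 + expR s)) - c =
      K * (lam * (1 + expR s)) + lam * (1 - expR s) - (c - al / lam).
    by rewrite /th /logistic_bend; field; rewrite ?gt_eqF ?expR1_gt0.
  have -> : c - al / lam = lam.
    have -> : al = c * lam - lam ^+ 2 by move: lamE; lra.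
    by field; rewrite gt_eqF.
  by rewrite mulrBr; move: lam0; lra.
- have D s := is_derive_fun_mul (is_derive_fun_cst mu s) (DEi s).
  apply: (compare (D := C / K) _ Dr D) => s.
    have : 0 <= mu * (1 + (expR s)^-1).
      by rewrite mulr_ge0 ?(ltW mu0)// addr_ge0 ?invr_ge0 ?expR_ge0.
    by have := rub s; lra.
  (* Likewise [mu * (1 + e^(-s))] is exact for the bound [b1 * (1 + e^(-s))], because
     [b1 / mu = mu + c]. *)
  have := rhs_le s _ _ (rm s) (reaction_le_mu arho DH (Hsig s)).
  have -> : b1 * (1 + (expR s)^-1) / (mu * (1 + (expR s)^-1)) +
      (K + th s) * (mu * (1 + (expR s)^-1)) - c =
      K * (mu * (1 + (expR s)^-1)) + mu * (expR s)^-1.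
    rewrite /b1 /th /logistic_bend; field.
    by rewrite !gt_eqF ?expR_gt0 ?expR1_gt0// addrC expR1_gt0.
  by rewrite mulrBr; lra.
- move=> s t st.
  have KrC u : 0 <= K * r u <= C.
    by rewrite mulr_ge0 ?(ltW K0)//= mulrC -ler_pdivlMr.
  have dr u : `|K * r u - N u| <= 2 * C.
    rewrite ler_norml; have /andP[? ?] := KrC u; have /andP[? ?] := N0C u.
    by apply/andP; split; lra.
  move: st; rewrite le_eqVlt => /predU1P[->|st]; first by rewrite !subrr normr0 mulr0.
  have [x _ ->] := mean_value st (fun u _ => Dr u).
  by rewrite normrM (gtr0_norm (_ : 0 < t - s)) ?subr_gt0// ler_pM2r ?subr_gt0.
Qed.

Lemma stationary_speed : exists2 rho, admissible_speed rho &
  next_speed rho rho.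
Proof.
(* The subsolutions: admissible speeds lying below their image. *)
pose A := [set rho | admissible_speed rho /\
  exists r, [/\ admissible_speed r, next_speed rho r & forall s, rho s <= r s]].
have Anu : A (fun _ => nu).
  have anu : admissible_speed (fun _ => nu).
    split => [//|s|s|s t st].
    - apply: (le_trans nu_lam); rewrite -[leLHS]mulr1 ler_pM2l// lerDl; exact: expR_ge0.
    - by apply: (le_trans nu_mu); rewrite -[leLHS]mulr1 ler_pM2l// lerDl invr_ge0 expR_ge0.
    - by rewrite subrr normr0 mulr_ge0 ?mulr_ge0 ?(ltW C0)// subr_ge0.
  split=> //; have [r ar nr] := next_speed_exists anu.
  by exists r; split => //; case: ar.
pose rho s := sup [set r s | r in A].
have hA s : has_ubound [set r s | r in A].
  by exists M => _ [r [ar _] <-]; exact: adm_M.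
have rho_ge r s : A r -> r s <= rho s.
  by move=> Ar; apply: ub_le_sup => //; exists r.
have rho_le s u : (forall r, A r -> r s <= u) -> rho s <= u.
  move=> h; apply: ge_sup; first by exists nu; exists (fun _ => nu).
  by move=> _ [r Ar <-]; exact: h.
(* Pointwise suprema keep the bounds and the common Lipschitz constant, hence also continuity. *)
have arho : admissible_speed rho.
  split=> [s|s|s|s t st].
  - exact: (rho_ge _ s Anu).
  - by apply: rho_le => r [[]].
  - by apply: rho_le => r [[]].
  - have h1 : rho s <= rho t + 2 * C * (t - s).
      apply: rho_le => r Ar; have [[_ _ _ Lr] _] := Ar; have := Lr s t st.
      by rewrite ler_norml => /andP[h _]; have := rho_ge _ t Ar; lra.
    have h2 : rho t <= rho s + 2 * C * (t - s).
      apply: rho_le => r Ar; have [[_ _ _ Lr] _] := Ar; have := Lr s t st.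
      by rewrite ler_norml => /andP[_ h]; have := rho_ge _ s Ar; lra.
    by rewrite ler_norml; apply/andP; split; lra.
(* The supremum lies below its image [r] by monotonicity; then [r] lies below its own image, so it
   belongs to [A] and is below the supremum. *)
have [r ar nr] := next_speed_exists arho.
have rho_r s : rho s <= r s.
  apply: rho_le => q Aq; have [aq [q' [aq' nq qq']]] := Aq.
  apply: (le_trans (qq' s)); apply: (next_speed_mono aq arho aq' ar nq nr).
  by move=> t; exact: rho_ge.
have [r' ar' nr'] := next_speed_exists ar.
have Ar : A r.
  split=> //; exists r'; split => //.
  exact: (next_speed_mono arho ar ar ar' nr nr' rho_r).
have rE : r = rho.
  by apply/funext => s; apply/le_anti; rewrite rho_r rho_ge.
by exists rho => //; rewrite -{2}rE.
Qed.
(* With [drho/ds] from the fixed-point equation, [phi = logistic (Hi t)] solves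
   the profile equation; the delay [tau] is travel time in [H]. *)
Lemma increasing_front_exists : exists phi dphi : R -> R,
  [/\ forall t, is_derive t 1 phi (dphi t),
      forall t, is_derive t 1 dphi (c * dphi t - f (phi t, phi (t - tau))),
      forall t, 0 < phi t < kappa, {homo phi : s t / s <= t} &
      phi t @[t --> -oo] --> (0 : R) /\ phi t @[t --> +oo] --> kappa].
Proof.
have [rho arho [H' [sig [DH' Hsig Drho]]]] := stationary_speed.
have [nur _ _ _] := arho; have r0 := adm_gt0 arho.
have [H [Hi [DH HK HiK DHi]]] : exists H Hi, [/\ forall s, is_derive s 1 H (rho s)^-1,
    cancel H Hi, cancel Hi H & forall t, is_derive t 1 Hi (rho (Hi t))].
  apply: (@travel_time R rho nu M nu0 (adm_cont arho)) => s.
  by rewrite nur adm_M.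
(* The travel times [H'] and [H] differ by a constant, so the delayed position of [next_speed] is
   the one read off the trajectory [Hi]. *)
have sigE s : sig s = Hi (H s - tau).
  have H'H : H' (sig s) - H (sig s) = H' s - H s.
    have D t : is_derive t 1 (fun t => H' t - H t) 0.
      have D := is_derive_fun_add (DH' t) (is_derive_fun_opp (DH t)).
      by apply: is_derive_eq D _; rewrite subrr.
    have ss := delay_le arho DH' (Hsig s).
    apply/le_anti/andP; split.
      by apply: (derive_ge0_ler ss (fun t _ => D t)).
    by apply: (derive_le0_ler ss (fun t _ => D t)).
  by rewrite -[LHS]HK; congr Hi; have := Hsig s; lra.
have Hi_le s t : s <= t -> nu * (t - s) <= Hi t - Hi s.
  move=> st; have D u := is_derive_fun_add (DHi u) (is_derive_fun_opp (is_derive_fun_lin nu 0 u)).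
  have := derive_ge0_ler st (fun u _ => D u).
  suff P u : 0 <= rho (Hi u) - nu by move=> /(_ (fun u _ => P u)) /=; rewrite !subr0 mulrBr; lra.
  by rewrite subr_ge0.
pose phi t := xs (Hi t).
pose dphi t := om (Hi t) * rho (Hi t).
have Dphi t : is_derive t 1 phi (dphi t).
  exact: is_derive_fun_comp (is_derive_logistic _ _) (DHi t).
exists phi, dphi; split => //.
- move=> t; have D := is_derive_fun_mul
    (is_derive_fun_comp (is_derive_logistic_slope kappa _) (DHi t))
    (is_derive_fun_comp (Drho (Hi t)) (DHi t)).
  apply: is_derive_eq D _.
  rewrite sigE HiK -/(om (Hi t)) /dphi /phi /rhs /reaction -/(th (Hi t)).
  by field; rewrite !gt_eqF.
- by move=> t; exact: xsI.
- move=> s t st; apply: logistic_le => //.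
  by rewrite -subr_ge0; apply: le_trans (Hi_le _ _ st); rewrite mulr_ge0 ?subr_ge0// ltW.
(* [Hi] grows at least at rate [nu], so after time [A] it is past [B], and before [- A] it is below
   [- B]; there [expR B >= 1 + B > kappa / e] gives distance less than [e] to the limit. *)
have phi_lim e : 0 < e -> exists2 A, forall t, t <= - A -> phi t < e &
    forall t, A <= t -> kappa - e < phi t.
  move=> e0; pose B := kappa / e; pose A := (B + `|Hi 0|) / nu.
  have B0 : 0 < B by exact: divr_gt0.
  have nuA : nu * A = B + `|Hi 0| by rewrite /A mulrC divfK// gt_eqF.
  have A0 : 0 <= A by rewrite /A divr_ge0 ?(ltW nu0)// addr_ge0 ?(ltW B0).
  have n1 := ler_norm (Hi 0); have n2 := ler_norm (- Hi 0); rewrite normrN in n2.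
  exists A => t tA.
    have t0 : t <= 0 by lra.
    have := Hi_le _ _ t0; rewrite sub0r mulrN.
    have : nu * A <= - (nu * t) by rewrite -mulrN ler_pM2l//; lra.
    rewrite nuA => h1 h2; have h3 : B <= - Hi t by lra.
    have := expR_ge1Dx (- Hi t); rewrite expRN => h4.
    have kE : kappa * expR (Hi t) < e.
      rewrite -ltr_pdivlMr ?expR_gt0// [e / _]mulrC -ltr_pdivrMr// -/B; lra.
    apply: le_lt_trans kE; rewrite /phi /xs logisticE//.
    have -> : logistic_slope kappa (Hi t) * (1 + expR (Hi t)) =
        kappa * expR (Hi t) / (1 + expR (Hi t)).
      by rewrite /logistic_slope; field; rewrite gt_eqF ?expR1_gt0.
    rewrite ler_pdivrMr ?expR1_gt0// ler_peMr ?lerDl ?expR_ge0//.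
    by rewrite mulr_ge0 ?(ltW kappa0)// expR_ge0.
  have t0 : 0 <= t by lra.
  have := Hi_le _ _ t0; rewrite subr0.
  have : nu * A <= nu * t by rewrite ler_pM2l.
  rewrite nuA => h1 h2; have h3 : B <= Hi t by lra.
  have h4 := expR_ge1Dx (Hi t).
  have : kappa - phi t < e.
    rewrite /phi /xs logistic_compl// ltr_pdivrMr ?expR1_gt0//.
    by rewrite mulrC -ltr_pdivrMr// -/B; lra.
  by lra.
have phi0 t : 0 < phi t < kappa by exact: xsI.
split; apply/cvgrPdist_lt => e e0; have [A h1 h2] := phi_lim e e0.
  near=> t; have /andP[p0 _] := phi0 t; rewrite sub0r normrN gtr0_norm//; apply: h1.
  by near: t; exact: nbhs_ninfty_le (num_real _).
near=> t; have /andP[_ p0] := phi0 t; rewrite gtr0_norm ?subr_gt0// ltrBlDl -ltrBlDr.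
apply: h2; near: t; exact: nbhs_pinfty_ge (num_real _).
Unshelve. all: by end_near. Qed.

End SlowestSpeed.

(** * Bounds on a KPP nonlinearity *)

Section Partials.
Context {R : realType}.
Implicit Types (f g : R * R -> R) (x y M e gamma : R) (p q : R * R).

Lemma is_derive_pd1 f x y : derivable f (x, y) ((1, 0) : R * R) ->
  is_derive x 1 (fun t => f (t, y)) (pd1 f (x, y)).
Proof.
move=> df.
have E : (fun h : R => h^-1 *: (((fun t => f (t, y)) \o shift x) (h *: (1 : R)) - f (x, y))) =
    (fun h : R => h^-1 *: ((f \o shift (x, y)) (h *: ((1, 0) : R * R)) - f (x, y))).
  apply/funext => h; congr (_ *: (_ - _)); rewrite /shift /=; congr f.
  by congr pair; rewrite /= /GRing.scale /= mulr0 add0r.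
by split; rewrite /derivable /pd1 /derive E.
Qed.

Lemma is_derive_pd2 f x y : derivable f (x, y) ((0, 1) : R * R) ->
  is_derive y 1 (fun t => f (x, t)) (pd2 f (x, y)).
Proof.
move=> df.
have E : (fun h : R => h^-1 *: (((fun t => f (x, t)) \o shift y) (h *: (1 : R)) - f (x, y))) =
    (fun h : R => h^-1 *: ((f \o shift (x, y)) (h *: ((0, 1) : R * R)) - f (x, y))).
  apply/funext => h; congr (_ *: (_ - _)); rewrite /shift /=; congr f.
  by congr pair; rewrite /= /GRing.scale /= mulr0 add0r.
by split; rewrite /derivable /pd2 /derive E.
Qed.

Lemma hoelder_uniform gamma g M e : 0 < gamma -> locally_hoelder gamma g -> 0 < e ->
  exists2 d, 0 < d & forall p q, `|p| <= M -> `|q| <= M -> `|p - q| < d -> `|g p - g q| < e.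
Proof.
move=> g0 /(_ M) [C0 hC] e0.
(* The constant [C0] may be nonpositive, so it is replaced by one at least [1] before dividing. *)
pose C := Num.max C0 1.
have C1 : 0 < C by rewrite lt_max ltr01 orbT.
have eC : 0 < e / C by exact: divr_gt0.
exists ((e / C) `^ gamma^-1); first exact: powR_gt0.
move=> p q pM qM pq.
apply: (@le_lt_trans _ _ (C * `|p - q| `^ gamma)).
  apply: (le_trans (hC p q pM qM)); apply: ler_wpM2r; first exact: powR_ge0.
  by rewrite le_max lexx.
rewrite mulrC -ltr_pdivlMr//.
have -> : e / C = ((e / C) `^ gamma^-1) `^ gamma.
  by rewrite -powRrM mulVf ?gt_eqF// powRr1// ltW.
by apply: gt0_ltr_powR; rewrite ?nnegrE ?powR_ge0.
Qed.

Lemma hoelder_bounded gamma g M : 0 < gamma -> locally_hoelder gamma g ->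
  exists2 B, 0 < B & forall p, `|p| <= M -> `|g p| <= B.
Proof.
move=> g0 /(_ M)[C hC].
exists (`|g 0| + `|C| * M `^ gamma + 1) => [|p pM].
  by rewrite ltr_pwDr// addr_ge0// mulr_ge0// powR_ge0.
have M0 : 0 <= M by exact: le_trans pM.
have zM : `|0 : R * R| <= M by rewrite normr0.
have := hC p 0 pM zM; rewrite subr0 => h1.
have h2 : C * `|p| `^ gamma <= `|C| * M `^ gamma.
  apply: (@le_trans _ _ (`|C| * `|p| `^ gamma)).
    by rewrite ler_wpM2r ?powR_ge0// ler_norm.
  by rewrite ler_wpM2l// ge0_ler_powR ?nnegrE// ltW.
have h3 : `|g p| <= `|g 0| + `|g p - g 0|.
  by rewrite -[X in `|X| <= _](subrKC (g 0)) ler_normD.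
lra.
Qed.

Lemma prod_norm_le x y M : `|x| <= M -> `|y| <= M -> `|(x, y) : R * R| <= M.
Proof. by move=> xM yM; rewrite /Num.norm /= ge_max xM yM. Qed.

(** The partial derivatives are bounded on a box, so moving one coordinate at a time gives a
    Lipschitz estimate there. *)
Lemma C1gamma_continuous gamma f : 0 < gamma -> C1gamma gamma f -> continuous f.
Proof.
move=> g0 [d1 d2 h1 h2] [x y].
(* The extra [1] keeps all points at distance less than [1] inside the box. *)
pose M := Num.max `|x| `|y| + 1.
have xM : `|x| <= M - 1 by rewrite /M addrK le_max lexx.
have yM : `|y| <= M - 1 by rewrite /M addrK le_max lexx orbT.
have [B1 B10 hB1] := hoelder_bounded M g0 h1.
have [B2 B20 hB2] := hoelder_bounded M g0 h2.
have lip (F dF : R -> R) (B a b : R) : 0 < B -> (forall t : R, is_derive t 1 F (dF t)) ->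
    `|a| <= M -> `|b| <= M -> (forall t : R, `|t| <= M -> `|dF t| <= B) ->
    `|F a - F b| <= B * `|a - b|.
  move=> B0 DF; wlog ab : a b / a < b => [hw|].
    case: (ltgtP a b) => [ab|ba|->]; first exact: hw.
      by move=> aM bM hB; rewrite distrC (distrC a); exact: hw.
    by rewrite !subrr !normr0 mulr0.
  move=> aM bM hB; have [t /andP[at_ tb] E] := mean_value ab (fun t _ => DF t).
  rewrite distrC (distrC a) E normrM ler_wpM2r// hB//.
  by move: aM bM; rewrite !ler_norml => /andP[? ?] /andP[? ?]; apply/andP; split; lra.
have key (x' y' : R) : `|x'| <= M -> `|y'| <= M ->
    `|f (x, y) - f (x', y')| <= B1 * `|x - x'| + B2 * `|y - y'|.
  move=> x'M y'M.
  have -> : f (x, y) - f (x', y') = (f (x, y) - f (x', y)) + (f (x', y) - f (x', y')) by ring.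
  apply: (le_trans (ler_normD _ _)); apply: lerD.
    apply: (lip (fun t => f (t, y)) (fun t => pd1 f (t, y))) => //; last 2 first.
    - by lra.
    - by move=> t tM; apply: hB1; apply: prod_norm_le => //; lra.
    by move=> t; exact: is_derive_pd1.
  apply: (lip (fun t => f (x', t)) (fun t => pd2 f (x', t))) => //; last 2 first.
  - by lra.
  - by move=> t tM; apply: hB2; apply: prod_norm_le.
  by move=> t; exact: is_derive_pd2.
apply/cvgrPdist_lt => e e0.
pose d := Num.min 1 (e / (B1 + B2)).
have B0 : 0 < B1 + B2 by exact: addr_gt0.
have dpos : 0 < d by rewrite lt_min ltr01 divr_gt0.
exists (ball x d, ball y d) => /=.
  by split; apply/nbhs_ballP; exists d.
move=> [x' y'] /= [hx hy].
have dx : `|x - x'| < d by exact: hx.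
have dy : `|y - y'| < d by exact: hy.
have d1' : d <= 1 by rewrite ge_min lexx.
have de : (B1 + B2) * d <= e by rewrite mulrC -ler_pdivlMr// ge_min lexx orbT.
have nb (a b : R) : `|a| <= M - 1 -> `|a - b| < d -> `|b| <= M.
  rewrite ler_norml ltr_norml ler_norml => /andP[? ?] /andP[? ?].
  by apply/andP; split; lra.
apply: (le_lt_trans (key _ _ (nb _ _ xM dx) (nb _ _ yM dy))).
apply: lt_le_trans de; rewrite mulrDl ltrD// ltr_pM2l//.
Qed.

End Partials.

(** * One-sided bounds on [f] in the open square *)

Section KPPBounds.
Context {R : realType}.
Variables (f : R * R -> R) (kappa : R).
Hypotheses (kappa0 : 0 < kappa) (hf : KPP_type f kappa).
Implicit Types x y z d e : R.

Let al := pd1 f (0, 0).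
Let b := - pd2 f (kappa, kappa).

Let hC1 : exists gamma, 0 < gamma /\ C1gamma gamma f.
Proof. by case: hf => _ [g [/andP[g0 _] h]] _ _ _; exists g. Qed.

Lemma KPP_al_gt0 : 0 < al. Proof. by case: hf => _ _ []. Qed.
Lemma KPP_b_gt0 : 0 < b. Proof. by rewrite /b oppr_gt0; case: hf => _ _ []. Qed.

Lemma KPP_continuous : continuous f.
Proof. by have [g [g0 h]] := hC1; exact: C1gamma_continuous g0 h. Qed.

Let D1 x y : is_derive x 1 (fun t => f (t, y)) (pd1 f (x, y)).
Proof. by have [g [_ [d _ _ _]]] := hC1; exact: is_derive_pd1. Qed.

Let D2 x y : is_derive y 1 (fun t => f (x, t)) (pd2 f (x, y)).
Proof. by have [g [_ [_ d _ _]]] := hC1; exact: is_derive_pd2. Qed.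

Let f0 y : f (0, y) = 0. Proof. by case: hf. Qed.

Let hfI x y : 0 < x < kappa -> 0 < y < kappa ->
  [/\ 0 < pd1 f (x, y) <= al, pd2 f (x, y) <= 0 &
      0 < f (x, y) <= pd2 f (kappa, kappa) * (y - kappa)].
Proof. by case: hf => _ _ _ _; exact. Qed.

Lemma KPP_gt0 x y : 0 < x < kappa -> 0 < y < kappa -> 0 < f (x, y).
Proof. by move=> hx hy; have [_ _ /andP[]] := hfI hx hy. Qed.

Lemma KPP_le_r x y : 0 < x < kappa -> 0 < y < kappa -> f (x, y) <= b * (kappa - y).
Proof.
move=> hx hy; have [_ _ /andP[_ h]] := hfI hx hy.
by apply: (le_trans h); rewrite /b; lra.
Qed.

Lemma KPP_le_l x y : 0 < x < kappa -> 0 < y < kappa -> f (x, y) <= al * x.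
Proof.
move=> hx hy; have /andP[x0 xk] := hx.
have [t /andP[t0 tx]] := mean_value x0 (fun t _ => D1 t y).
rewrite f0 !subr0 => ->; rewrite ler_pM2r//.
have ht : 0 < t < kappa by rewrite t0 (lt_trans tx).
by have [/andP[]] := hfI ht hy.
Qed.

Lemma KPP_decr x y z : 0 < x < kappa -> 0 < y < kappa -> 0 < z < kappa ->
  y <= z -> f (x, z) <= f (x, y).
Proof.
move=> hx /andP[y0 _] /andP[_ zk] yz.
apply: (derive_le0_ler yz (fun t _ => D2 x t)) => t /andP[yt tz].
have ht : 0 < t < kappa by rewrite (lt_le_trans y0 yt) (le_lt_trans tz zk).
by have [_ + _] := hfI hx ht.
Qed.

(** As [f (0, y) = 0], the mean value theorem gives [f (x, y) = f_1 (t, y) * x] with [t < x], and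
    [f_1] is close to [al] near the origin. *)
Lemma KPP_ge_near0 e : 0 < e -> exists2 d, 0 < d & forall x y,
  0 < x < d -> 0 < y < d -> (al - e) * x <= f (x, y).
Proof.
move=> e0; have [g [g0 [_ _ h1 _]]] := hC1.
have [d d0 hd] := hoelder_uniform 1 g0 h1 e0.
exists (Num.min d 1) => [|x y]; first by rewrite lt_min d0 ltr01.
rewrite !lt_min => /and3P[x0 xd x1] /and3P[y0 yd y1].
have [t /andP[t0 tx]] := mean_value x0 (fun t _ => D1 t y).
rewrite f0 !subr0 => ->; rewrite ler_pM2r//.
have n0 : `|((0, 0) : R * R)| <= 1 by apply: prod_norm_le; rewrite normr0.
have nt : `|((t, y) : R * R)| <= 1 by apply: prod_norm_le; rewrite gtr0_norm//; lra.
have : `|((0, 0) : R * R) - (t, y)| < d.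
  by rewrite /Num.norm /= gt_max !sub0r !normrN !gtr0_norm// yd andbT (lt_trans tx).
by move=> /(hd _ _ n0 nt); rewrite -/al ltr_norml => /andP[_]; lra.
Qed.

(** Positivity of [f] is given only inside the square, so [f_2], which is close to [- b], is
    integrated from [y] to some [z < kappa], and [z] is then taken close to [kappa]. *)
Lemma KPP_ge_nearkappa b' : b' < b -> exists2 d, 0 < d & forall x y,
  kappa - d < x < kappa -> kappa - d < y < kappa -> b' * (kappa - y) <= f (x, y).
Proof.
move=> bb'; have e0 : 0 < b - b' by rewrite subr_gt0.
have [g [g0 [_ _ _ h2]]] := hC1.
have [d d0 hd] := hoelder_uniform kappa g0 h2 e0.
exists (Num.min d kappa) => [|x y]; first by rewrite lt_min d0.
move=> /andP[xd xk] /andP[yd yk].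
have md : Num.min d kappa <= d by rewrite ge_min lexx.
have mk : Num.min d kappa <= kappa by rewrite ge_min lexx orbT.
have hx : 0 < x < kappa by apply/andP; split; lra.
suff H z : y < z -> z < kappa -> b' * (z - y) <= f (x, y).
  have cb : continuous (fun z : R => b' * (z - y)).
    by move=> z; exact: is_derive_continuous (is_derive_fun_lin _ _ _).
  rewrite leNgt; apply/negP => hlt.
  have db : 0 < b' * (kappa - y) - f (x, y) by rewrite subr_gt0.
  have b'0 : 0 < b'.
    have hy : 0 < y < kappa by apply/andP; split; lra.
    have : 0 < b' * (kappa - y) by have := KPP_gt0 hx hy; lra.
    by rewrite pmulr_lgt0// subr_gt0.
  (* The second entry makes [b' * (kappa - z)] at most half of the assumed gap; the midpoint keeps
     [z] to the right of [y]. *)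
  pose z := Num.max ((y + kappa) / 2) (kappa - (b' * (kappa - y) - f (x, y)) / (2 * b')).
  have zy : y < z by rewrite lt_max; apply/orP; left; lra.
  have zk : z < kappa.
    by rewrite gt_max ltrBlDr ltrDl divr_gt0 ?mulr_gt0// andbT; lra.
  have := H z zy zk.
  have : kappa - z <= (b' * (kappa - y) - f (x, y)) / (2 * b').
    by rewrite lerBlDr -lerBlDl le_max lexx orbT.
  rewrite ler_pdivlMr ?mulr_gt0// => h3.
  have -> : b' * (z - y) = b' * (kappa - y) - b' * (kappa - z) by ring.
  by lra.
move=> yz zk; have [t /andP[ty tz]] := mean_value yz (fun t _ => D2 x t).
have hz : 0 < z < kappa by apply/andP; split; lra.
have := KPP_gt0 hx hz => fz E.
suff : pd2 f (x, t) * (z - y) <= - b' * (z - y) by lra.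
rewrite ler_pM2r ?subr_gt0//.
have nk : `|((kappa, kappa) : R * R)| <= kappa by apply: prod_norm_le; rewrite gtr0_norm.
have x0 : 0 < x by case/andP: hx.
have t0 : 0 < t by lra.
have tk : t < kappa by lra.
have nt : `|((x, t) : R * R)| <= kappa by apply: prod_norm_le; rewrite gtr0_norm// ltW.
have : `|((kappa, kappa) : R * R) - (x, t)| < d.
  have xd' : kappa - x < d by lra.
  have td' : kappa - t < d by lra.
  by rewrite /Num.norm /= gt_max !gtr0_norm ?subr_gt0// xd'.
by move=> /(hd _ _ nk nt); rewrite ltr_norml => /andP[+ _]; rewrite /b; lra.
Qed.

(** The two local bounds give slopes [al / 2] at [0] and [b / 2] at [kappa]; in between, [f] has a
    positive minimum on the diagonal. *)
Lemma KPP_diag_ge : exists2 k, 0 < k & forall x, 0 < x < kappa ->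
  k * (x * (kappa - x)) <= f (x, x).
Proof.
have al0 := KPP_al_gt0; have b0 := KPP_b_gt0.
have a2 : 0 < al / 2 by lra.
have b2 : b / 2 < b by lra.
have [d1 d10 h1] := KPP_ge_near0 a2.
have [d2 d20 h2] := KPP_ge_nearkappa b2.
have cg : continuous (fun x => f (x, x)).
  move=> x; apply: (continuous_comp (g := f)); last exact: KPP_continuous.
  exact: (@cvg_pair _ _ _ (nbhs x) (nbhs x) (nbhs x) _ _ _ id id).
pose d := Num.min (Num.min d1 d2) (kappa / 2) / 2.
have d0 : 0 < d by rewrite /d divr_gt0// !lt_min d10 d20 divr_gt0.
have dd1 : d < d1.
  have : Num.min (Num.min d1 d2) (kappa / 2) <= d1 by rewrite !ge_min lexx.
  by move: d0; rewrite /d; lra.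
have dd2 : d < d2.
  have : Num.min (Num.min d1 d2) (kappa / 2) <= d2 by rewrite !ge_min lexx !orbT.
  by move: d0; rewrite /d; lra.
have dk : d <= kappa - d.
  have : Num.min (Num.min d1 d2) (kappa / 2) <= kappa / 2 by rewrite !ge_min lexx !orbT.
  by move: d0; rewrite /d; lra.
have [xm xmI hm] := EVT_min dk (continuous_subspaceT cg).
have xmI' : 0 < xm < kappa.
  by move: xmI; rewrite in_itv /= => /andP[? ?]; apply/andP; split; lra.
have m0 := KPP_gt0 xmI' xmI'.
pose k := Num.min (Num.min (al / 2 / kappa) (b / 2 / kappa)) (f (xm, xm) / kappa ^+ 2).
have k0 : 0 < k by rewrite !lt_min !divr_gt0// exprn_gt0.
exists k => // x /andP[x0 xk].
have kx0 : 0 < kappa - x by rewrite subr_gt0.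
have [xd|xd] := ltP x d.
  have xd1 : 0 < x < d1 by rewrite x0 (lt_trans xd).
  apply: (@le_trans _ _ (al / 2 / kappa * (x * kappa))).
    apply: ler_pM; [exact: ltW|by rewrite mulr_ge0 ?ltW| |].
      by rewrite /k !ge_min lexx.
    by rewrite ler_pM2l// lerBlDr lerDl ltW.
  have -> : al / 2 / kappa * (x * kappa) = al / 2 * x by field; rewrite gt_eqF.
  by apply: le_trans (h1 x x xd1 xd1); rewrite ler_pM2r//; lra.
have [xd'|xd'] := ltP (kappa - d) x.
  have xd2 : kappa - d2 < x < kappa by rewrite xk andbT; lra.
  apply: (@le_trans _ _ (b / 2 / kappa * (kappa * (kappa - x)))).
    apply: ler_pM; [exact: ltW|by rewrite mulr_ge0 ?ltW| |].
      by rewrite /k !ge_min lexx !orbT.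
    by rewrite ler_pM2r// ltW.
  by rewrite mulrA divfK ?gt_eqF//; exact: h2.
apply: (@le_trans _ _ (f (xm, xm) / kappa ^+ 2 * (kappa * kappa))).
  apply: ler_pM; [exact: ltW|by rewrite mulr_ge0 ?ltW| |].
    by rewrite /k !ge_min lexx !orbT.
  by apply: ler_pM; rewrite ?ltW//; lra.
rewrite -expr2 divfK ?expf_neq0 ?gt_eqF//.
by apply: hm; rewrite in_itv /= xd xd'.
Qed.

End KPPBounds.

(** * Necessity *)

Section Necessity.
Context {R : realType}.
Variables (f : R * R -> R) (kappa : R).
Hypotheses (kappa0 : 0 < kappa) (hf : KPP_type f kappa).
Variables (c tau : R) (phi dphi : R -> R).
Implicit Types (s t d l m w T : R).
Hypotheses (c0 : 0 < c) (tau0 : 0 <= tau).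
Let F (t : R) := f (phi t, phi (t - tau)).
Hypotheses (Dphi : forall t : R, is_derive t 1 phi (dphi t))
  (D2phi : forall t : R, is_derive t 1 dphi (c * dphi t - F t))
  (phiI : forall t, 0 < phi t < kappa)
  (phi_le : {homo phi : s t / s <= t})
  (phiNy : phi t @[t --> -oo] --> (0 : R))
  (phiy : phi t @[t --> +oo] --> kappa).

Let al := pd1 f (0, 0).
Let b := - pd2 f (kappa, kappa).
Let al0 : 0 < al := KPP_al_gt0 hf.
Let b0 : 0 < b := KPP_b_gt0 hf.
Let F0 t : 0 < F t. Proof. by apply: (KPP_gt0 hf). Qed.

(** The integrating factor removes [c * phi'], so positivity of [F] makes the damped derivative
    decrease. *)
Let damped (t0 t : R) : is_derive t 1 (fun s => expR (- c * (s - t0)) * dphi s)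
  (- (expR (- c * (t - t0)) * F t)).
Proof.
have D := is_derive_fun_mul (is_derive_fun_exp_lin (- c) t0 t) (D2phi t).
by apply: is_derive_eq D _; ring.
Qed.

(** Were [phi'] nonpositive at [t0], the damped derivative would be negative ever after, against
    monotonicity. *)
Let dphi_gt0 (t0 : R) : 0 < dphi t0.
Proof.
rewrite ltNge; apply/negP => h.
have neg t : t0 < t -> dphi t < 0.
  move=> tt; have [x _] := mean_value tt (fun s _ => damped t0 s).
  rewrite subrr mulr0 expR0 mul1r => E.
  have : 0 < expR (- c * (x - t0)) * F x * (t - t0).
    by rewrite !mulr_gt0 ?expR_gt0 ?subr_gt0.
  have : expR (- c * (t - t0)) * dphi t < 0 -> dphi t < 0.
    by rewrite pmulr_rlt0// expR_gt0.
  by move=> H1 H2; apply: H1; lra.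
have h12 : t0 + 1 < t0 + 2 by lra.
have [x /andP[x1 _] E] := mean_value h12 (fun s _ => Dphi s).
have x0 : t0 < x by lra.
have := neg x x0; have := phi_le (ltW h12).
have -> : dphi x = phi (t0 + 2) - phi (t0 + 1) by rewrite E; ring.
by lra.
Qed.

Let phi_near0 d : 0 < d -> exists T, forall t, t <= T -> phi t < d.
Proof.
move=> d0; move/cvgrPdist_lt : phiNy => /(_ d d0)[T [_ hT]].
exists (T - 1) => t tT; have tT' : t < T by lra.
have := hT t tT' => /=; rewrite sub0r normrN gtr0_norm//.
by case/andP: (phiI t).
Qed.

Let phi_nearkappa d : 0 < d -> exists T, forall t, T <= t -> kappa - d < phi t.
Proof.
move=> d0; move/cvgrPdist_lt : phiy => /(_ d d0)[T [_ hT]].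
exists (T + 1) => t tT; have tT' : T < t by lra.
have := hT t tT' => /=; rewrite gtr0_norm ?subr_gt0; first by lra.
by case/andP: (phiI t).
Qed.

(* If [c ^ 2 < 4 al] then [phi / phi'] has derivative bounded below near
   [-oo], so it would become negative. *)
Lemma front_speed_ge : 4 * al <= c ^+ 2.
Proof.
rewrite leNgt; apply/negP => hc.
(* The midpoint of [c ^ 2 / 4] and [al], so that [c ^ 2 < 4 * a] and [a < al]. *)
pose a := (al + c ^+ 2 / 4) / 2.
have c2 : 0 < c ^+ 2 by exact: exprn_gt0.
have a0 : 0 < a by rewrite /a; lra.
have e0 : 0 < al - a by rewrite /a; lra.
have [d d0 hd] := KPP_ge_near0 hf e0.
have [T hT] := phi_near0 d0.
have Fa t : t <= T -> a * phi t <= F t.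
  move=> tT; have := hd (phi t) (phi (t - tau)).
  have -> : pd1 f (0, 0) - (al - a) = a by rewrite /al; ring.
  apply; first by rewrite hT// andbT; case/andP: (phiI t).
  by rewrite hT ?andbT; [case/andP: (phiI (t - tau))|move: tau0; lra].
pose e := 1 - c ^+ 2 / (4 * a).
have ep : 0 < e.
  have a4 : 0 < 4 * a by lra.
  by rewrite /e subr_gt0 ltr_pdivrMr// /a; lra.
pose u t := phi t * (dphi t)^-1.
have dn t : dphi t != 0 by rewrite gt_eqF.
have Du t : is_derive t 1 u (1 - c * u t + F t * phi t / dphi t ^+ 2).
  apply: is_derive_eq (is_derive_fun_mul (Dphi t) (is_derive_fun_inv (dn t) (D2phi t))) _.
  by rewrite /u; field.
have u0 t : 0 < u t by rewrite divr_gt0//; case/andP: (phiI t).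
have du t : t <= T -> e <= 1 - c * u t + F t * phi t / dphi t ^+ 2.
  move=> tT; have h1 : a * u t ^+ 2 <= F t * phi t / dphi t ^+ 2.
    have -> : a * u t ^+ 2 = a * phi t * phi t / dphi t ^+ 2 by rewrite /u; field.
    rewrite ler_pM2r ?invr_gt0 ?exprn_gt0// ler_pM2r; first exact: Fa.
    by case/andP: (phiI t).
  have h2 : 0 <= a * (u t - c / (2 * a)) ^+ 2 by rewrite mulr_ge0 ?sqr_ge0// ltW.
  have h3 : a * (u t - c / (2 * a)) ^+ 2 = a * u t ^+ 2 - c * u t + c ^+ 2 / (4 * a).
    by field; rewrite gt_eqF.
  by rewrite h3 in h2; rewrite /e; lra.
(* Here the line of slope [e] through [(T, u T)] reaches zero, and [u] lies below this line to the
   left of [T]. *)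
pose t := T - u T / e.
have tT : t <= T by rewrite /t lerBlDr lerDl divr_ge0 ?ltW.
have D s := is_derive_fun_add (Du s) (is_derive_fun_opp (is_derive_fun_lin e T s)).
have := derive_ge0_ler tT (fun s _ => D s).
suff P s : t <= s <= T -> 0 <= 1 - c * u s + F s * phi s / dphi s ^+ 2 - e.
  move=> /(_ P) /=; rewrite subrr mulr0 subr0.
  have -> : e * (t - T) = - u T by rewrite /t; field; rewrite gt_eqF.
  by have := u0 t; lra.
by case/andP=> _ sT; rewrite subr_ge0; exact: du.
Qed.

Let psi t := kappa - phi t.
Let psi0 t : 0 < psi t. Proof. by rewrite subr_gt0; case/andP: (phiI t). Qed.
Let psi_ge s t : s <= t -> psi t <= psi s.
Proof. by move=> /phi_le; rewrite /psi; lra. Qed.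
Let Dpsi t : is_derive t 1 psi (- dphi t).
Proof.
have D := is_derive_fun_add (is_derive_fun_cst kappa t) (is_derive_fun_opp (Dphi t)).
by apply: is_derive_eq D _; rewrite add0r.
Qed.

Let reaction_ge (b' : R) : b' < b -> exists T, forall t, T <= t -> b' * psi (t - tau) <= F t.
Proof.
move=> /(KPP_ge_nearkappa kappa0 hf)[d d0 hd].
have [T hT] := phi_nearkappa d0; exists (T + tau) => t tT.
have t1 : T <= t by move: tau0; lra.
have t2 : T <= t - tau by lra.
have /andP[_ k1] := phiI t; have /andP[_ k2] := phiI (t - tau).
by apply: hd; rewrite ?k1 ?k2 andbT hT.
Qed.

(** Since [psi' = - phi'], this says that [psi] decays at least like [e^(- l t)] beyond [T]. *)
Let decay_rate l T := forall t, T <= t -> l * psi t <= dphi t.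

Let decay_expR l T s t : decay_rate l T -> T <= s -> s <= t ->
  expR (l * (t - s)) * psi t <= psi s.
Proof.
move=> hl Ts st.
have D u := is_derive_fun_mul (is_derive_fun_exp_lin l s u) (Dpsi u).
have := derive_le0_ler st (fun u _ => D u).
rewrite /= subrr mulr0 expR0 mul1r; apply => u /andP[su _].
have -> : expR (l * (u - s)) * l * psi u + expR (l * (u - s)) * - dphi u =
  expR (l * (u - s)) * (l * psi u - dphi u) by ring.
by rewrite pmulr_rle0 ?expR_gt0// subr_le0; apply: hl; exact: le_trans su.
Qed.

(* The delayed term bounds [psi (t - tau / 2) / psi (t - tau / 4)]. *)
Let decay_rate_bounded : 0 < tau -> exists U : R, forall l T, decay_rate l T -> l <= U.
Proof.
move=> taup; have b2 : b / 2 < b by move: b0; lra.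
have [T0 hT0] := reaction_ge b2.
pose k := expR (- c * (tau / 2)) * (b / 2) * (tau / 2).
have k0 : 0 < k by rewrite !mulr_gt0 ?expR_gt0 ?divr_gt0.
(* The drop of the damped derivative over [[t, t + tau / 2]] bounds [phi' t] below; on this interval
   the delayed time is at most [t - tau / 2]. *)
have step1 t : T0 <= t -> k * psi (t - tau / 2) <= dphi t.
  move=> tT; have tt : t < t + tau / 2 by lra.
  have [x /andP[tx xt]] := mean_value tt (fun s _ => damped t s).
  rewrite subrr mulr0 expR0 mul1r addrAC subrr add0r => E.
  have : 0 < expR (- c * (tau / 2)) * dphi (t + tau / 2) by rewrite mulr_gt0 ?expR_gt0.
  suff : k * psi (t - tau / 2) <= expR (- c * (x - t)) * F x * (tau / 2) by lra.
  rewrite /k mulrAC ler_pM2r ?divr_gt0// -mulrA.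
  apply: ler_pM; rewrite ?expR_ge0 ?mulr_ge0 ?(ltW b0) ?(ltW (psi0 _))//.
    by rewrite ler_expR !mulNr lerN2 ler_pM2l//; lra.
  apply: (@le_trans _ _ (b / 2 * psi (x - tau))).
    by rewrite ler_pM2l ?divr_gt0//; apply: psi_ge; lra.
  by apply: hT0; lra.
(* A further quarter of the delay integrates the bound on [phi'] into one on [psi]. *)
have step2 t : T0 + tau / 4 <= t -> k * (tau / 4) * psi (t - tau / 2) <= psi (t - tau / 4).
  move=> tT; have tt : t - tau / 4 < t by lra.
  have [x /andP[tx xt] E] := mean_value tt (fun s _ => Dpsi s).
  have h1 : psi (t - tau / 4) = psi t + dphi x * (tau / 4).
    by apply/eqP; rewrite -subr_eq0; apply/eqP; move: E; lra.
  rewrite h1 -[leLHS]add0r; apply: lerD; first exact: ltW.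
  rewrite mulrAC ler_pM2r ?divr_gt0//.
  apply: (@le_trans _ _ (k * psi (x - tau / 2))).
    by rewrite ler_pM2l//; apply: psi_ge; lra.
  by apply: step1; lra.
(* A rate [l] shrinks [psi] by [e^(l tau / 4)] over a quarter delay, so this factor is at most
   [(k * (tau / 4))^-1]; then [1 + x <= e^x] bounds [l]. *)
exists ((k * (tau / 4))^-1 / (tau / 4)) => l T hl.
pose t := Num.max T T0 + tau.
have tT : T <= t - tau by rewrite /t addrK le_max lexx.
have tT0 : T0 <= t - tau by rewrite /t addrK le_max lexx orbT.
have h2 : k * (tau / 4) * psi (t - tau / 2) <= psi (t - tau / 4).
  by apply: step2; lra.
have h1 : expR (l * (tau / 4)) * psi (t - tau / 4) <= psi (t - tau / 2).
  have -> : tau / 4 = (t - tau / 4) - (t - tau / 2) by field.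
  have -> : t - (t - tau / 4 - (t - tau / 2)) = t - tau / 4 by field.
  by apply: (decay_expR hl); lra.
have kt : 0 < k * (tau / 4) by rewrite mulr_gt0 ?divr_gt0.
have h3 : k * (tau / 4) * expR (l * (tau / 4)) <= 1.
  rewrite -(ler_pM2r (psi0 (t - tau / 4))) mul1r; apply: le_trans h2.
  by rewrite -(mulrA (k * (tau / 4))) ler_pM2l.
rewrite ler_pdivlMr ?divr_gt0//.
have h4 : expR (l * (tau / 4)) <= (k * (tau / 4))^-1.
  by rewrite -[leRHS]mul1r ler_pdivlMr// mulrC.
by have := expR_ge1Dx (l * (tau / 4)); lra.
Qed.

(** The difference [w = phi' - m * psi] obeys [w' <= (c + m) * w] once [F >= m * (m + c) * psi], and
    the rate [l] over one delay supplies the factor [e^(l tau)] for this. As [w] is bounded below,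
    [bounded_growth_ge0] applies. *)
Let decay_rate_improve l m (b' : R) T : 0 <= m -> b' < b -> 0 < b' ->
  m * (m + c) <= b' * expR (l * tau) -> decay_rate l T -> exists T', decay_rate m T'.
Proof.
move=> m0 b'b b'0 hm hl; have [T1 hT1] := reaction_ge b'b.
exists (Num.max T T1 + tau) => t0 tt0; rewrite -subr_ge0.
have cm : 0 < c + m by rewrite ltr_pwDl.
have D s := is_derive_fun_add (D2phi s)
  (is_derive_fun_opp (is_derive_fun_mul (is_derive_fun_cst m s) (Dpsi s))).
apply: (@bounded_growth_ge0 R (fun s => dphi s - m * psi s) _ (c + m) (m * kappa) t0 cm
  (fun s _ => D s)) => s st.
  have Ts : T <= s - tau.
    have : T <= Num.max T T1 by rewrite le_max lexx.
    by lra.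
  have T1s : T1 <= s.
    have : T1 <= Num.max T T1 by rewrite le_max lexx orbT.
    by move: tau0; lra.
  have h1 := hT1 s T1s.
  have sts : s - tau <= s by move: tau0; lra.
  have h2 := decay_expR hl Ts sts; rewrite opprB addrC subrK in h2.
  have h3 : b' * (expR (l * tau) * psi s) <= b' * psi (s - tau) by rewrite ler_pM2l.
  have h4 : m * (m + c) * psi s <= b' * (expR (l * tau) * psi s).
    by rewrite [leRHS]mulrA ler_pM2r.
  rewrite mul0r add0r; have -> : (c + m) * (dphi s - m * psi s) =
    c * dphi s + m * dphi s - m * (m + c) * psi s by ring.
  lra.
have : m * psi s <= m * kappa.
  by rewrite ler_wpM2l// /psi; case/andP: (phiI s); lra.
by have := dphi_gt0 s; lra.
Qed.

(** Otherwise the strict inequality at the supremum [L] of all decay rates leaves room to pass from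
    a rate close to [L] to the rate [L + d]. *)
Lemma front_decay_rate : 0 < tau ->
  exists2 w, 0 <= w & b * expR (tau * w) <= w ^+ 2 + c * w.
Proof.
move=> taup; apply: contrapT => hno.
have no w : 0 <= w -> w ^+ 2 + c * w < b * expR (tau * w).
  by move=> w0; rewrite ltNge; apply/negP => hw; apply: hno; exists w.
pose A := [set l : R | exists T, decay_rate l T].
have A0 : A 0 by exists 0 => t _; rewrite mul0r ltW.
have [U hU] := decay_rate_bounded taup.
have hA : has_sup A by split; [exists 0|exists U => l [T]; exact: hU].
pose L := sup A.
have L0 : 0 <= L by apply: ub_le_sup => //; case: hA.
pose P := L ^+ 2 + c * L; pose Q := b * expR (tau * L).
have PQ : P < Q by exact: no.
have P0 : 0 <= P by rewrite addr_ge0 ?mulr_ge0 ?sqr_ge0// ltW.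
(* [D] collects the losses per unit of [d]: the growth of [(L + d) * (L + d + c)] above [P] and the
   drop of [b * (1 - d) * e^(tau (L - d))] below [Q]. *)
pose D := 2 * L + 1 + c + Q * (1 + tau).
have D0 : 0 < D.
  have : 0 < Q * (1 + tau) by rewrite mulr_gt0 ?addr_gt0// (le_lt_trans P0).
  by rewrite /D; move: c0; lra.
pose d := Num.min (1 / 2) ((Q - P) / D).
have d0 : 0 < d by rewrite lt_min !divr_gt0// subr_gt0.
have d2 : d <= 1 / 2 by rewrite ge_min lexx.
have dD : d * D <= Q - P by rewrite -ler_pdivlMr// ge_min lexx orbT.
have [l [T hl] Ll] := sup_adherent d0 hA.
suff [T' hT'] : exists T', decay_rate (L + d) T'.
  have : L + d <= L by apply: ub_le_sup; [case: hA|exists T'].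
  lra.
pose b' := b * (1 - d).
have b'0 : 0 < b' by rewrite mulr_gt0//; lra.
apply: (@decay_rate_improve l (L + d) b' T) => //; first by lra.
  by rewrite /b' mulrBr mulr1 ltrBlDr ltrDl mulr_gt0.
have e1 : expR (tau * L) * (1 - tau * d) <= expR (l * tau).
  apply: (@le_trans _ _ (expR (tau * L) * expR (- (tau * d)))).
    by rewrite ler_pM2l ?expR_gt0//; have := expR_ge1Dx (- (tau * d)); lra.
  rewrite -expRD ler_expR -mulrN -mulrDr [l * tau]mulrC ler_pM2l//.
  by rewrite -/L in Ll; lra.
have e2 : Q * (1 - d) * (1 - tau * d) <= b' * expR (l * tau).
  have -> : Q * (1 - d) * (1 - tau * d) = b' * (expR (tau * L) * (1 - tau * d)).
    by rewrite /Q /b'; ring.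
  by rewrite ler_pM2l.
apply: le_trans e2.
have h1 : (L + d) * (L + d + c) = P + d * (2 * L + d + c) by rewrite /P; ring.
have h2 : d * (2 * L + d + c) <= d * (2 * L + 1 + c) by rewrite ler_pM2l//; lra.
have h3 : Q * (1 - d) * (1 - tau * d) = Q - d * (Q * (1 + tau)) + Q * tau * d ^+ 2.
  by ring.
have h4 : 0 <= Q * tau * d ^+ 2.
  by rewrite mulr_ge0 ?sqr_ge0// mulr_ge0 ?(ltW taup)// ltW// (le_lt_trans P0).
have h5 : d * D = d * (2 * L + 1 + c) + d * (Q * (1 + tau)) by rewrite /D; ring.
by lra.
Qed.

End Necessity.

(** * Critical speeds *)

Section CriticalSpeedCharacterization.
Context {R : realType}.
Implicit Types al b h c s w z tau mu : R.

Lemma quadratic_root_iff al h c : 0 < c ->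
  (exists z, char_fun al 0 h c z = 0) <-> 4 * al <= c ^+ 2.
Proof.
move=> c0; rewrite /char_fun; split=> [[z]|hc].
  rewrite mul0r addr0 => E; have := sqr_ge0 (2 * z - c).
  have -> : (2 * z - c) ^+ 2 = 4 * (z ^+ 2 - c * z + al) + (c ^+ 2 - 4 * al) by ring.
  by rewrite E; lra.
exists ((c + Num.sqrt (c ^+ 2 - 4 * al)) / 2).
set r := Num.sqrt _; have r2 : r ^+ 2 = c ^+ 2 - 4 * al by rewrite sqr_sqrtr// subr_ge0.
have -> : ((c + r) / 2) ^+ 2 - c * ((c + r) / 2) + al + 0 * expR (- (c * h * ((c + r) / 2))) =
  (r ^+ 2 - (c ^+ 2 - 4 * al)) / 4 by field.
by rewrite r2 subrr mul0r.
Qed.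

(** [2 * Num.sqrt al] lies in the defining set of [c0L], so [xget] returns an element of this set
    rather than its default. *)
Lemma c0L_le al h c : 0 < al -> 0 < c -> (c0L al 0 h <= c) <-> (4 * al <= c ^+ 2).
Proof.
move=> al0 c0; rewrite /c0L.
set S := (X in xget _ X).
have S2 : S (2 * Num.sqrt al).
  split; first by rewrite mulr_gt0// sqrtr_gt0.
  move=> c' c'0; rewrite quadratic_root_iff//.
  have -> : 4 * al = (2 * Num.sqrt al) ^+ 2.
    by rewrite exprMn sqr_sqrtr ?(ltW al0)//; ring.
  by rewrite ler_sqr ?nnegrE ?mulr_ge0 ?sqrtr_ge0// ltW.
have [_ H] := xgetPex 0 (ex_intro _ _ S2).
by rewrite -quadratic_root_iff//; split => [|] /(H c c0).
Qed.

(** The difference of the two sides is [- b < 0] at [0] and nonnegative at [w], so the intermediate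
    value theorem applies. *)
Lemma positive_root b c tau w : 0 < b -> 0 < c -> 0 <= w ->
  b * expR (tau * w) <= w ^+ 2 + c * w ->
  exists2 mu, 0 < mu & mu ^+ 2 + c * mu = b * expR (mu * tau).
Proof.
move=> b0 c0 w0 hw.
pose g s := s ^+ 2 + c * s - b * expR (tau * (s - 0)).
have cg : continuous g.
  move=> s; have D := is_derive_fun_add (is_derive_fun_add
    (is_derive_fun_mul (is_derive_fun_id s) (is_derive_fun_id s)) (is_derive_fun_lin c 0 s))
    (is_derive_fun_opp (is_derive_fun_mul (is_derive_fun_cst b s) (is_derive_fun_exp_lin tau 0 s))).
  have -> : g = fun t => t * t + c * (t - 0) + - (b * expR (tau * (t - 0))).
    by apply/funext => t; rewrite /g subr0 expr2.
  exact: is_derive_continuous D.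
have g0 : g 0 < 0 by rewrite /g subrr !mulr0 expR0 expr0n /=; lra.
have gw : 0 <= g w by rewrite /g subr0 subr_ge0.
have [|s] := @IVT R g 0 w 0 w0 (continuous_subspaceT cg).
  by rewrite ge_min le_max (ltW g0) gw orbT.
rewrite in_itv /= => /andP[s0 _] gs; exists s.
  by rewrite lt_neqAle s0 andbT; apply/eqP => s00; move: g0; rewrite [X in g X]s00 gs ltxx.
by apply/eqP; rewrite -subr_eq0; apply/eqP; rewrite -gs /g subr0 [s * tau]mulrC.
Qed.

(** With [z = - w] the equation may be weakened to an inequality, since [positive_root] recovers a
    root from it. *)
Lemma negative_root_iff b h c : 0 < b -> 0 < c ->
  (exists z, z < 0 /\ char_fun 0 (- b) h c z = 0) <->
  (exists2 w, 0 <= w & b * expR (c * h * w) <= w ^+ 2 + c * w).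
Proof.
move=> b0 c0; rewrite /char_fun; split=> [[z [z0 E]]|[w w0 hw]].
  exists (- z); first by rewrite oppr_ge0 ltW.
  by rewrite sqrrN !mulrN; lra.
have [mu mu0 E] := positive_root b0 c0 w0 hw.
exists (- mu); rewrite oppr_lt0; split=> //.
by rewrite sqrrN !mulrN !opprK [c * h * mu]mulrC; lra.
Qed.

(** The substitution [s = c * w] leaves [c] only in [(s / c) ^ 2], so the condition is visibly
    weaker for smaller [c]. *)
Let slow b h c := exists2 s, 0 <= s & b * expR (h * s) <= s + (s / c) ^+ 2.

Let slow_iff b h c : 0 < c ->
  (exists2 w, 0 <= w & b * expR (c * h * w) <= w ^+ 2 + c * w) <-> slow b h c.
Proof.
move=> c0; split=> -[w w0 hw].
  exists (c * w); first by rewrite mulr_ge0// ltW.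
  have -> : c * w / c = w by rewrite mulrC mulKf// gt_eqF.
  by rewrite mulrA [h * c]mulrC addrC.
exists (w / c); first by rewrite divr_ge0// ltW.
have -> : c * h * (w / c) = h * w by field; rewrite gt_eqF.
have -> : c * (w / c) = w by rewrite mulrC divfK// gt_eqF.
by rewrite addrC.
Qed.

Let slow_le b h c c' : 0 < c' -> c' <= c -> slow b h c -> slow b h c'.
Proof.
move=> c'0 cc' [s s0 hs]; exists s => //; apply: (le_trans hs).
have c0 : 0 < c by exact: lt_le_trans cc'.
rewrite lerD2l ler_sqr ?nnegrE ?divr_ge0 ?(ltW c0) ?(ltW c'0)//.
by rewrite ler_wpM2l// lef_pV2 ?posrE.
Qed.

(** Cubic growth suffices to beat the quadratic term of [slow] for large [s]. *)
Lemma expR_ge_cube (x : R) : 0 <= x -> (x / 3) ^+ 3 <= expR x.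
Proof.
move=> x0; have -> : expR x = expR (x / 3) ^+ 3.
  by rewrite -expRM_natl; congr expR; field.
have x30 : 0 <= x / 3 by rewrite divr_ge0.
rewrite lerXn2r ?nnegrE ?expR_ge0//.
by have := expR_ge1Dx (x / 3); lra.
Qed.

(** Beyond [s1] the exponential wins for every speed at least [c / 2], and on [[0, s1]] the gap has
    a positive minimum, so failure persists for a slightly smaller speed. This makes the supremum of
    the slow speeds slow. *)
Let slow_closed b h c : 0 < b -> 0 < h -> 0 < c -> ~ slow b h c ->
  exists c', [/\ 0 < c', c' < c & ~ slow b h c'].
Proof.
move=> b0 h0 c0 ns.
have {}ns s : 0 <= s -> 0 < b * expR (h * (s - 0)) - (s - 0) - (s / c) ^+ 2.
  by move=> s0; rewrite !subr0 ltNge; apply/negP => hs; apply: ns; exists s => //; lra.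
pose B := b * (h / 3) ^+ 3; pose A := 1 + 4 / c ^+ 2.
have B0 : 0 < B by rewrite mulr_gt0 ?exprn_gt0 ?divr_gt0.
have A1 : 1 <= A by rewrite lerDl divr_ge0 ?exprn_ge0// ltW.
pose s1 := A / B + 1.
have AB : 0 <= A / B by rewrite divr_ge0 ?(ltW B0)//; lra.
have s10 : 0 < s1 by rewrite /s1; lra.
have large s : s1 <= s -> s + 4 * (s / c) ^+ 2 < b * expR (h * s).
  move=> s1s; have s0 : 0 < s by lra.
  have h1 : B * s ^+ 3 <= b * expR (h * s).
    have -> : B * s ^+ 3 = b * ((h * s / 3) ^+ 3) by rewrite /B; field.
    by rewrite ler_pM2l// expR_ge_cube// mulr_ge0 ?ltW.
  apply: lt_le_trans h1.
  have h2 : A * s ^+ 2 < B * s ^+ 3.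
    rewrite [s ^+ 3]exprS mulrA ltr_pM2r ?exprn_gt0// mulrC -ltr_pdivrMr//.
    by move: s1s; rewrite /s1; lra.
  apply: le_lt_trans h2.
  have -> : A * s ^+ 2 = s ^+ 2 + 4 * (s / c) ^+ 2 by rewrite /A; field; rewrite gt_eqF.
  by rewrite lerD2r expr2 ler_peMl ?(ltW s0)//; move: s1s; rewrite /s1; lra.
pose g s := b * expR (h * (s - 0)) - (s - 0) - (s / c) ^+ 2.
have cg : continuous g.
  move=> s; have Dsc := is_derive_fun_mul (is_derive_fun_id s) (is_derive_fun_cst c^-1 s).
  have D := is_derive_fun_add (is_derive_fun_add
    (is_derive_fun_mul (is_derive_fun_cst b s) (is_derive_fun_exp_lin h 0 s))
    (is_derive_fun_opp (is_derive_fun_add (is_derive_fun_id s) (is_derive_fun_cst (- 0) s))))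
    (is_derive_fun_opp (is_derive_fun_mul Dsc Dsc)).
  exact: is_derive_continuous D.
have [sm smI hm] := EVT_min (ltW s10) (continuous_subspaceT cg).
have m0 : 0 < g sm by apply: ns; move: smI; rewrite in_itv /= => /andP[].
(* The bound [d <= 1] gives [(1 + d) ^ 2 <= 1 + 3 * d], and the second entry keeps the change of the
   quadratic term at most half of the minimum [g sm]. *)
pose d := Num.min 1 (g sm * c ^+ 2 / (6 * s1 ^+ 2)).
have d0 : 0 < d by rewrite lt_min ltr01 divr_gt0 ?mulr_gt0 ?exprn_gt0.
have d1 : d <= 1 by rewrite ge_min lexx.
have dm : d * (6 * s1 ^+ 2) <= g sm * c ^+ 2.
  by rewrite -ler_pdivlMr ?mulr_gt0 ?exprn_gt0// ge_min lexx orbT.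
have dp : 0 < 1 + d by rewrite addr_gt0.
exists (c / (1 + d)); split; first exact: divr_gt0.
  by rewrite ltr_pdivrMr// ltr_pMr// ltrDl.
case=> s s0.
have -> : (s / (c / (1 + d))) ^+ 2 = (s / c) ^+ 2 * (1 + d) ^+ 2.
  by field; rewrite !gt_eqF.
have q0 : 0 <= (s / c) ^+ 2 by exact: sqr_ge0.
have [s1s|ss1] := leP s1 s.
  have := large s s1s; have : (s / c) ^+ 2 * (1 + d) ^+ 2 <= (s / c) ^+ 2 * 4.
    rewrite ler_wpM2l//; have -> : (4 : R) = 2 ^+ 2 by ring.
    by rewrite ler_sqr ?nnegrE ?(ltW dp)//; lra.
  by lra.
have := hm s; rewrite in_itv /= s0 (ltW ss1) => /(_ isT) => gs.
have : (s / c) ^+ 2 * (1 + d) ^+ 2 <= (s / c) ^+ 2 + 3 * d * (s / c) ^+ 2.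
  have -> : (s / c) ^+ 2 + 3 * d * (s / c) ^+ 2 = (s / c) ^+ 2 * (1 + 3 * d) by ring.
  rewrite ler_wpM2l//; have : d ^+ 2 <= d by rewrite expr2 ler_piMl// ltW.
  by rewrite sqrrD; lra.
have : 3 * d * (s / c) ^+ 2 < g sm.
  have h1 : 3 * d * (s / c) ^+ 2 <= 3 * d * (s1 / c) ^+ 2.
    rewrite ler_wpM2l ?mulr_ge0 ?(ltW d0)//.
    rewrite ler_sqr ?nnegrE ?divr_ge0 ?(ltW c0) ?(ltW s10)//.
    by rewrite ler_pM2r ?invr_gt0// ltW.
  apply: (le_lt_trans h1).
  have -> : 3 * d * (s1 / c) ^+ 2 = d * (6 * s1 ^+ 2) / c ^+ 2 / 2 by field; rewrite gt_eqF.
  have : d * (6 * s1 ^+ 2) / c ^+ 2 <= g sm by rewrite ler_pdivrMr ?exprn_gt0.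
  by lra.
by move: gs; rewrite /g !subr0; lra.
Qed.

(** For [h > 0] the slow speeds form a down-closed set of positive reals; its supremum, attained by
    [slow_closed], or [+oo] if it is unbounded, lies in the set from which [xget] chooses. *)
Lemma ckL_le b h c : 0 < b -> 0 <= h -> 0 < c ->
  (c%:E <= ckL 0 (- b) h)%E <->
  (exists2 w, 0 <= w & b * expR (c * h * w) <= w ^+ 2 + c * w).
Proof.
move=> b0 h0 c0; rewrite /ckL; case: eqP => [->|/eqP hn].
  split=> [_|_]; last exact: leey.
  (* Without delay [c * w = b] already suffices. *)
  exists (b / c); first by rewrite divr_ge0 ?ltW.
  rewrite mulr0 mul0r expR0 mulr1 [c * _]mulrC divfK ?gt_eqF//.
  by rewrite lerDr sqr_ge0.
have hp : 0 < h by rewrite lt_neqAle eq_sym hn.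
set S := (X in xget _ X).
suff [ck Sck] : exists ck, S ck.
  have [_ H] := xgetPex +oo%E (ex_intro _ _ Sck).
  by rewrite -negative_root_iff//; split => [|] /(H c c0).
have SE ck : (0 < ck)%E -> (forall c, 0 < c -> slow b h c <-> (c%:E <= ck)%E) -> S ck.
  by move=> ck0 H; split=> // c' c'0; rewrite negative_root_iff// slow_iff//; exact: H.
pose T := [set c : R | 0 < c /\ slow b h c].
(* This speed is slow with witness [s = 1], as [(1 / c1) ^ 2 >= b * e^h]. *)
pose c1 := (1 + b * expR h)^-1.
have be0 : 0 < b * expR h by rewrite mulr_gt0 ?expR_gt0.
have c10 : 0 < c1 by rewrite invr_gt0 addr_gt0.
have Tc1 : T c1.
  split=> //; exists 1 => //; rewrite /c1 invrK mulr1 mul1r sqrrD expr1n mul1r.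
  by have := sqr_ge0 (b * expR h); lra.
have [hT|nT] := pselect (has_ubound T).
  have sT : has_sup T by split; [exists c1|].
  exists (sup T)%:E; apply: SE => [|c' c'0].
    by rewrite lte_fin; apply: lt_le_trans c10 _; exact: ub_le_sup.
  rewrite lee_fin; split=> [hs|c's]; first by apply: ub_le_sup.
  apply: contrapT => ns; have [c2 [c20 c2c' ns2]] := slow_closed b0 hp c'0 ns.
  have e0 : 0 < c' - c2 by rewrite subr_gt0.
  have [c3 [c30 s3] c3s] := sup_adherent e0 sT.
  by apply: ns2; apply: slow_le s3 => //; lra.
exists +oo%E; apply: SE => [|c' c'0]; first exact: ltry.
split=> [_|_]; first exact: leey.
apply: contrapT => ns; apply: nT; exists c' => c2 [c20 s2].
by rewrite leNgt; apply/negP => c'c2; apply: ns; apply: slow_le s2 => //; exact: ltW.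
Qed.

End CriticalSpeedCharacterization.

(** * Plane waves *)

Section PlaneWaves.
Context {R : realType} {m : nat}.
Implicit Types (nu x y : 'rV[R]_m) (F phi : R -> R) (a t l : R).

Lemma dotv_basis_shift nu x (i : 'I_m) (s : R) :
  dotv nu (s *: basis_vec R i + x) = s * nu 0 i + dotv nu x.
Proof.
rewrite /dotv (eq_bigr (fun j => s * (nu 0 j * (basis_vec R i) 0 j) + nu 0 j * x 0 j)).
  rewrite big_split /= -mulr_sumr; congr (_ * _ + _).
  rewrite (bigD1 i) //= big1 ?addr0 => [|j ji]; rewrite /basis_vec mxE eqxx /=.
    by rewrite eqxx mulr1.
  by rewrite (negbTE ji) mulr0.
by move=> j _; rewrite !mxE; ring.
Qed.

Lemma is_derive_ridge F nu x a l (i : 'I_m) : is_derive (dotv nu x + a) 1 F l ->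
  is_derive x (basis_vec R i) (fun y => F (dotv nu y + a)) (l * nu 0 i).
Proof.
move=> dF; pose g (s : R) := F (nu 0 i * (s - 0) + (dotv nu x + a)).
have [dg Dg] : is_derive (0 : R) 1 g (l * nu 0 i).
  have E : nu 0 i * (0 - 0) + (dotv nu x + a) = dotv nu x + a by rewrite subrr mulr0 add0r.
  rewrite -E in dF.
  have D := is_derive_fun_add (is_derive_fun_lin (nu 0 i) 0 0)
    (is_derive_fun_cst (dotv nu x + a) 0).
  have := is_derive_fun_comp (g := fun s => nu 0 i * (s - 0) + (dotv nu x + a)) dF D.
  by rewrite addr0.
have E : (fun h : R => h^-1 *: ((g \o shift 0) (h *: (1 : R)) - g 0)) =
   (fun h : R => h^-1 *: (((fun y => F (dotv nu y + a)) \o shift x) (h *: basis_vec R i)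
      - F (dotv nu x + a))).
  apply/funext => h; congr (_ *: (_ - _)); rewrite /g /shift /=.
    by rewrite dotv_basis_shift; congr F; rewrite /GRing.scale /= mulr1 addr0 subr0; ring.
  by congr F; rewrite subrr mulr0 add0r.
by split; [rewrite /derivable -E|rewrite /derive -E].
Qed.

Lemma dotv_unit nu : enorm nu = 1 -> \sum_(i < m) nu 0 i * nu 0 i = 1.
Proof.
rewrite /enorm /dotv => E.
have S0 : 0 <= \sum_(i < m) nu 0 i * nu 0 i.
  by apply: sumr_ge0 => i _; rewrite -expr2 sqr_ge0.
by rewrite -[LHS]sqr_sqrtr// E expr1n.
Qed.

Variables (phi dphi d2phi : R -> R).
Hypotheses (Dphi : forall t : R, is_derive t 1 phi (dphi t))
  (D2phi : forall t : R, is_derive t 1 dphi (d2phi t)).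

Lemma derive_ridge nu a (i : 'I_m) :
  (fun y => 'D_(basis_vec R i) (fun x => phi (dotv nu x + a)) y) =
  (fun y => dphi (dotv nu y + a) * nu 0 i).
Proof. by apply/funext => y; have [_ ->] := is_derive_ridge i (Dphi (dotv nu y + a)). Qed.

Lemma is_derive_ridge2 nu x a (i : 'I_m) :
  is_derive x (basis_vec R i) (fun y => dphi (dotv nu y + a) * nu 0 i)
    (d2phi (dotv nu x + a) * nu 0 i * nu 0 i).
Proof.
apply: (is_derive_ridge (F := fun s => dphi s * nu 0 i)).
have D := is_derive_fun_mul (D2phi (dotv nu x + a)) (is_derive_fun_cst (nu 0 i) (dotv nu x + a)).
by apply: is_derive_eq D _; rewrite mulr0 addr0.
Qed.

(** The second partials are [phi'' * nu_i ^ 2], and these squares sum to [1]. *)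
Lemma laplacian_ridge nu x a : enorm nu = 1 ->
  laplacian (fun y => phi (dotv nu y + a)) x = d2phi (dotv nu x + a).
Proof.
move=> nu1; rewrite /laplacian -[RHS]mulr1 -(dotv_unit nu1) mulr_sumr.
apply: eq_bigr => i _; rewrite derive_ridge.
by have [_ ->] := is_derive_ridge2 nu x a i; rewrite mulrA.
Qed.

Lemma plane_wave_solution (f : R * R -> R) (h c : R) nu : c != 0 -> enorm nu = 1 ->
  is_solution f h (fun t x => phi (dotv nu x + c * t)) <->
  forall t, d2phi t = c * dphi t - f (phi t, phi (t - c * h)).
Proof.
move=> c0 nu1.
have Dt t x : derive1 (fun s => phi (dotv nu x + c * s)) t = c * dphi (dotv nu x + c * t) /\
    derivable (fun s => phi (dotv nu x + c * s)) t 1.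
  have D := is_derive_fun_add (is_derive_fun_cst (dotv nu x) t)
    (is_derive_fun_mul (is_derive_fun_cst c t) (is_derive_fun_id t)).
  have [d E] := is_derive_fun_comp (g := fun s => dotv nu x + c * s) (Dphi _) D.
  by split=> //; rewrite derive1E E; ring.
have shift_delay t x : dotv nu x + c * (t - h) = dotv nu x + c * t - c * h by ring.
split=> [sol t|ode t x].
  (* At [x = 0] and time [t / c] the phase equals [t]. *)
  have [_ _ _] := sol (t / c) 0.
  have [-> _] := Dt (t / c) 0.
  rewrite laplacian_ridge// shift_delay.
  have -> : dotv nu 0 + c * (t / c) = t.
    rewrite /dotv big1 => [|i _]; last by rewrite mxE mulr0.
    by rewrite add0r mulrC divfK.
  by move=> ->; ring.
split.
- by have [] := Dt t x.
- by move=> i; have [] := is_derive_ridge i (Dphi (dotv nu x + c * t)).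
- by move=> i; rewrite derive_ridge; have [] := is_derive_ridge2 nu x (c * t) i.
- by have [-> _] := Dt t x; rewrite laplacian_ridge// shift_delay ode; ring.
Qed.

End PlaneWaves.

Theorem theorem2p1 (R : realType) (f : R * R -> R) (kappa : R)
    (hkappa : 0 < kappa) (hf : KPP_type f kappa)
    (h c : R) (hh : 0 <= h) (hc : 0 < c)
    (m : nat) (nu : 'rV[R]_m) (hnu : enorm nu = 1) :
  has_monotone_front f kappa h c nu <-> DL f kappa (h, c).
Proof.
have al0 := KPP_al_gt0 hf; have b0 := KPP_b_gt0 hf.
have cn : c != 0 by rewrite gt_eqF.
have tau0 : 0 <= c * h by rewrite mulr_ge0// ltW.
have DLE : DL f kappa (h, c) <-> 4 * pd1 f (0, 0) <= c ^+ 2 /\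
    (exists2 w, 0 <= w & - pd2 f (kappa, kappa) * expR (c * h * w) <= w ^+ 2 + c * w).
  have [_ _ [_ beta0 alk _] _ _] := hf.
  rewrite -(c0L_le h al0 hc) -(ckL_le b0 hh hc) /DL /= beta0 alk opprK.
  by split=> [[]|[]].
rewrite DLE; split.
- case=> phi [[[d1 d2 _] phiI phi_le phiN phiY] sol].
  have Dphi (t : R) : is_derive t 1 phi (derive1 phi t) by rewrite derive1E; exact: derivableP.
  have D2phi (t : R) : is_derive t 1 (derive1 phi) (derive1 (derive1 phi) t).
    by rewrite derive1E; exact: derivableP.
  have ode := (plane_wave_solution Dphi D2phi f h cn hnu).1 sol.
  have D2phi' (t : R) : is_derive t 1 (derive1 phi)
      (c * derive1 phi t - f (phi t, phi (t - c * h))).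
    by rewrite -ode.
  split; first exact: (front_speed_ge hf hc tau0 Dphi D2phi' phiI phi_le phiN).
  have [tau1|tau1] := ltP 0 (c * h).
    exact: (front_decay_rate hkappa hf hc tau0 Dphi D2phi' phiI phi_le phiY tau1).
  have -> : c * h = 0 by apply/le_anti; rewrite tau1.
  exists (- pd2 f (kappa, kappa) / c); first by rewrite divr_ge0 ?ltW.
  rewrite mul0r expR0 mulr1 [c * _]mulrC divfK// lerDr; exact: sqr_ge0.
- move=> [hal [w w0 hw]].
  have [mu mu0 muE] := positive_root b0 hc w0 hw.
  have [k k0 hk] := KPP_diag_ge hkappa hf.
  (* The larger root of [z ^ 2 - c * z + alpha_0], which is positive. *)
  pose lam := (c + Num.sqrt (c ^+ 2 - 4 * pd1 f (0, 0))) / 2.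
  have lam0 : 0 < lam by rewrite divr_gt0// ltr_pwDl// sqrtr_ge0.
  have lamE : lam ^+ 2 - c * lam + pd1 f (0, 0) = 0.
    have r2 : Num.sqrt (c ^+ 2 - 4 * pd1 f (0, 0)) ^+ 2 = c ^+ 2 - 4 * pd1 f (0, 0).
      by rewrite sqr_sqrtr// subr_ge0.
    have -> : lam ^+ 2 - c * lam + pd1 f (0, 0) =
        (Num.sqrt (c ^+ 2 - 4 * pd1 f (0, 0)) ^+ 2 - (c ^+ 2 - 4 * pd1 f (0, 0))) / 4.
      by rewrite /lam; field.
    by rewrite r2 subrr mul0r.
  have [phi [dphi [Dphi D2phi phiI phi_le [phiN phiY]]]] :=
    increasing_front_exists hkappa tau0 lam0 mu0 k0 al0 hc (KPP_continuous hf)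
      (KPP_gt0 hf) (KPP_le_l hf) (KPP_le_r hf) (KPP_decr hf) hk lamE muE.
  have dphiE : derive1 phi = dphi.
    by apply/funext => t; rewrite derive1E; have [_ ->] := Dphi t.
  exists phi; split; last by apply/(plane_wave_solution Dphi D2phi).
  split=> //; split.
  + by move=> t; have [] := Dphi t.
  + by move=> t; rewrite dphiE; have [] := D2phi t.
  have -> : derive1n 2 phi = fun t => c * dphi t - f (phi t, phi (t - c * h)).
    rewrite /= dphiE; apply/funext => t.
    by rewrite derive1E; have [_ ->] := D2phi t.
  have cphi : continuous phi by move=> t; exact: is_derive_continuous (Dphi t).
  have cdphi : continuous dphi by move=> t; exact: is_derive_continuous (D2phi t).
  have cphih : continuous (fun t => phi (t - c * h)).
    by move=> t; exact: is_derive_continuous (is_derive_fun_shift (Dphi _)).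
  move=> t.
  have cpair : {for t, continuous (fun t => (phi t, phi (t - c * h)))}.
    exact: (@cvg_pair _ _ _ (nbhs t) (nbhs (phi t)) (nbhs (phi (t - c * h))) _ _ _ phi
      (fun t => phi (t - c * h)) (cphi t) (cphih t)).
  have cf : {for t, continuous (fun t => f (phi t, phi (t - c * h)))}.
    exact: (continuous_comp (g := f) cpair (@KPP_continuous _ _ _ hf _)).
  exact: (continuousB (continuousM (@cst_continuous _ _ c t) (cdphi t)) cf).
Qed.
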